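(* Let $P(\lambda)=\begin{bmatrix}-A(\lambda)&B(\lambda)\\ C(\lambda)&D(\lambda)\end{bmatrix}\in\mathbb{C}[\lambda]^{(n+p)\times(n+p)}$ be a regular polynomial system matrix, with $A(\lambda)\in\mathbb{C}[\lambda]^{n\times n}$ regular and $D(\lambda)\in\mathbb{C}[\lambda]^{p\times p}$, and let $R(\lambda)=D(\lambda)+C(\lambda)A(\lambda)^{-1}B(\lambda)$ be its transfer function matrix. Assume that $\lambda_0\in\mathbb{C}$ is a simple eigenvalue (i.e. simple zero) of $R(\lambda)$ and that $P(\lambda)$ is minimal at $\lambda_0$. Let $x(\lambda)$ and $y(\lambda)$ be, respectively, right and left root vectors of $R(\lambda)$ associated with $\lambda_0$. Then the structured absolute condition number $\kappa_S(\lambda_0)$ (with respect to nonnegative weights $a_i,b_i,c_i,d_i$) is given by $$\kappa_S(\lambda_0)=\frac1K\begin{bmatrix}\|y(\lambda_0)^TC(\lambda_0)A(\lambda_0)^{-1}\|_2 & \|y(\lambda_0)\|_2\end{bmatrix}\,S(\lambda_0)\,\begin{bmatrix}\|A(\lambda_0)^{-1}B(\lambda_0)x(\lambda_0)\|_2\\ \|x(\lambda_0)\|_2\end{bmatrix},$$ where $$K:=\lim_{\lambda\to\lambda_0}|y(\lambda)^TR'(\lambda)x(\lambda)|,\qquad S(\lambda):=\begin{bmatrix}\sum_{i=0}^{k_A}a_i|\lambda|^i&\sum_{i=0}^{k_B}b_i|\lambda|^i\\ \sum_{i=0}^{k_C}c_i|\lambda|^i&\sum_{i=0}^{k_D}d_i|\lambda|^i\end{bmatrix}.$$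 Here $A(\lambda_0)^{-1}B(\lambda_0)x(\lambda_0)$ is shorthand for $\lim_{\lambda\to\lambda_0}A(\lambda)^{-1}B(\lambda)x(\lambda)$ and $y(\lambda_0)^TC(\lambda_0)A(\lambda_0)^{-1}$ is shorthand for $\lim_{\lambda\to\lambda_0}y(\lambda)^TC(\lambda)A(\lambda)^{-1}$ (these limits exist even if $\lambda_0$ is a pole of $R(\lambda)$).
   Context: A square polynomial or rational matrix is regular if its determinant is not identically zero. $P(\lambda)$ is minimal at $\lambda_0$ if $\begin{bmatrix}-A(\lambda)\\C(\lambda)\end{bmatrix}$ and $\begin{bmatrix}A(\lambda)&B(\lambda)\end{bmatrix}$ have no eigenvalue at $\lambda_0$, i.e. evaluated at $\lambda_0$ they have full column rank and full row rank $n$, respectively. For every regular rational matrix $R(\lambda)\in\mathbb{C}(\lambda)^{p\times p}$ and $\lambda_0\in\mathbb{C}$ there are rational matrices $G_1,G_2$ invertible at $\lambda_0$ (no pole at $\lambda_0$ and nonzero determinant there) with $G_1RG_2=\mathrm{diag}((\lambda-\lambda_0)^{\nu_1},\dots,(\lambda-\lambda_0)^{\nu_p})$, with uniquely determined integers $\nu_1\le\dots\le\nu_p$ (invariant orders at $\lambda_0$). $\lambda_0$ is a zero (eigenvalue) of $R$ if some $\nu_i>0$, a pole if some $\nu_i<0$; the zero is simple if exactly one $\nu_i$ is positive and it equals $1$ (negative $\nu_i$ are allowed, so a simple zero may also be a pole). A right root vector of $R(\lambda)$ associated with $\lambda_0$ is a rational vector $x(\lambda)\in\mathbb{C}(\lambda)^p$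 without pole at $\lambda_0$, with $x(\lambda_0)\ne0$ and $\lim_{\lambda\to\lambda_0}R(\lambda)x(\lambda)=0$; a left root vector is a rational vector $y(\lambda)\in\mathbb{C}(\lambda)^p$ without pole at $\lambda_0$, with $y(\lambda_0)\neq0$ and $\lim_{\lambda\to\lambda_0}y(\lambda)^TR(\lambda)=0$. Definition of $\kappa_S$. Write $A(\lambda)=\sum_{i=0}^{k_A}A_i\lambda^i$, $B(\lambda)=\sum_{i=0}^{k_B}B_i\lambda^i$, $C(\lambda)=\sum_{i=0}^{k_C}C_i\lambda^i$, $D(\lambda)=\sum_{i=0}^{k_D}D_i\lambda^i$, and consider perturbations $\Delta A(\lambda)=\sum_{i=0}^{k_A}\Delta A_i\lambda^i$, $\Delta B(\lambda)=\sum_{i=0}^{k_B}\Delta B_i\lambda^i$, $\Delta C(\lambda)=\sum_{i=0}^{k_C}\Delta C_i\lambda^i$, $\Delta D(\lambda)=\sum_{i=0}^{k_D}\Delta D_i\lambda^i$ with complex matrix coefficients of the same sizes, and $\Delta P(\lambda)=\begin{bmatrix}-\Delta A(\lambda)&\Delta B(\lambda)\\ \Delta C(\lambda)&\Delta D(\lambda)\end{bmatrix}$. Given nonnegative weights $a_i,b_i,c_i,d_i$ and $v$ a right eigenvector of $P(\lambda)$ associated with $\lambda_0$, $$\kappa_S(\lambda_0):=\lim_{\epsilon\to0}\sup\Big\{\frac{|\Delta\lambda_0|}{\epsilon}:\ [P(\lambda_0+\Delta\lambda_0)+\epsilon\Delta P(\lambda_0+\Delta\lambda_0)][v+\epsilon\Delta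 v]=0,\ \|\Delta A_i\|_2\le a_i,\|\Delta B_i\|_2\le b_i,\|\Delta C_i\|_2\le c_i,\|\Delta D_i\|_2\le d_i\Big\},$$ where $\epsilon>0$ and $\lambda_0+\Delta\lambda_0$ denotes the eigenvalue of $P(\lambda)+\epsilon\Delta P(\lambda)$ that arises from perturbing the simple eigenvalue $\lambda_0$, i.e. the unique eigenvalue (for small $\epsilon$) in a fixed small disc around $\lambda_0$ containing no other eigenvalue of $P(\lambda)$, depending analytically on $\epsilon$ and equal to $\lambda_0$ at $\epsilon=0$. *)

(* Defs.v *)
From HB Require Import structures.
From mathcomp Require Export all_boot all_order all_algebra.
From mathcomp Require Export all_classical all_reals all_analysis.
From mathcomp Require Export complex.

Set Implicit Arguments.
Unset Strict Implicit.
Unset Printing Implicit Defensive.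

Export Order.TTheory GRing.Theory Num.Theory.
Export numFieldNormedType.Exports.

Global Open Scope classical_set_scope.
Global Open Scope ring_scope.

(* The complex field is R[i] for R : realType, with its topology as a
   numFieldType; [cabs] is the modulus as an element of R (the norm `|z| of
   R[i] lives in R[i]). *)
Notation cabs := Normc.normc.

(* The field C(lambda) of rational functions and the embedding of C[lambda]. *)
Notation ratfun F := {fraction {poly F}}.
Notation tofrac := (@FracField.tofrac _).
Notation ratmx := (map_mx tofrac).

Section RationalFunctions.
Variable F : fieldType.
Implicit Types (f : ratfun F) (z : F).

(* Numerator and denominator in lowest terms (up to a common constant). *)
Definition rnum f : {poly F} :=
  (repr f).1 %/ gcdp (repr f).1 (repr f).2.
Definition rden f : {poly F} :=
  (repr f).2 %/ gcdp (repr f).1 (repr f).2.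

Definition no_pole f z : bool := ~~ root (rden f) z.

(* Value of f at z; junk (zero) when z is a pole of f. *)
Definition reval f z : F := (rnum f).[z] / (rden f).[z].

Lemma repr_fracE f : f = tofrac (repr f).1 / tofrac (repr f).2.
Proof.
have -> : tofrac (repr f).1 / tofrac (repr f).2
    = (\pi_(ratfun F) (Ratio (repr f).1 (repr f).2))%qT.
  unlock FracField.tofrac; rewrite -[_^-1]FracField.pi_inv.
  rewrite -[LHS]FracField.pi_mul /FracField.mulf /FracField.invf.
  by rewrite !numden_Ratio ?oner_eq0 ?denom_ratioP // mulr1 mul1r.
by rewrite Ratio_numden reprK.
Qed.

Lemma rden_dvd (p q : {poly F}) : q != 0 ->
  let f := tofrac p / tofrac q in
  exists k : {poly F}, q = rden f * k /\ p = rnum f * k.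
Proof.
move=> q0 f; set n := (repr f).1; set d := (repr f).2.
have d0 : d != 0 by exact: denom_ratioP.
have nq : n * q = d * p.
  apply/eqP; rewrite -tofrac_eq !rmorphM /=; apply/eqP.
  have := repr_fracE f; rewrite {1}/f -/n -/d => /eqP.
  rewrite eqr_div ?tofrac_eq0// => /eqP e.
  by rewrite -e mulrC.
have g0 : gcdp n d != 0 by rewrite gcdp_eq0 negb_and d0 orbT.
have eqn : n = rnum f * gcdp n d by rewrite divpK ?dvdp_gcdl.
have eqd : d = rden f * gcdp n d by rewrite divpK ?dvdp_gcdr.
have eq' : rnum f * q = rden f * p.
  by apply: (mulIf g0); rewrite mulrAC -eqn mulrAC -eqd.
have cop : coprimep (rden f) (rnum f).
  by rewrite coprimep_sym; apply: coprimep_div_gcd; rewrite d0 orbT.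
have : rden f %| q by rewrite -(Gauss_dvdpr _ cop) eq' dvdp_mulIl.
case/dvdpP => k qE; exists k; split; first by rewrite mulrC.
have rd0 : rden f != 0 by apply: contraNneq q0 => e; rewrite qE e mulr0.
by apply: (mulfI rd0); rewrite -eq' qE mulrA [RHS]mulrC.
Qed.

Lemma reval_frac (p q : {poly F}) z : q.[z] != 0 ->
  no_pole (tofrac p / tofrac q) z /\
  reval (tofrac p / tofrac q) z = p.[z] / q.[z].
Proof.
move=> qz; have q0 : q != 0 by apply: contraNneq qz => ->; rewrite horner0.
have [] := rden_dvd p q0; set f := _ / _ => k [qE pE].
move: qz; rewrite /no_pole /reval /root qE pE !hornerM mulf_eq0 negb_or.
by case/andP => dz kz; rewrite dz -mulf_div divff ?mulr1.
Qed.

End RationalFunctions.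

(* The usual topology and norm of C, those of any numFieldType. *)
HB.instance Definition _ (R : realType) := GRing.ComAlgebra.copy R[i] R[i]^o.
HB.instance Definition _ (R : realType) := Vector.copy R[i] R[i]^o.
HB.instance Definition _ (R : realType) := NormedModule.copy R[i] R[i]^o.

Section LocalStructure.
Variable R : realType.
Local Notation C := R[i].
Implicit Types z : C.

Definition pmeval m n (M : 'M[{poly C}]_(m, n)) z : 'M[C]_(m, n) :=
  map_mx (fun q : {poly C} => q.[z]) M.

Definition rmeval m n (M : 'M[ratfun C]_(m, n)) z : 'M[C]_(m, n) :=
  map_mx (fun f => reval f z) M.

(* Entrywise complex derivative at z. *)
Definition rmderiv m n (M : 'M[ratfun C]_(m, n)) z : 'M[C]_(m, n) :=
  \matrix_(i, j) derive1 (fun t : C => reval (M i j) t) z.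

Definition mx_no_pole m n (M : 'M[ratfun C]_(m, n)) z : Prop :=
  forall i j, no_pole (M i j) z.

Definition invertible_at p (G : 'M[ratfun C]_p) z : Prop :=
  mx_no_pole G z /\ \det (rmeval G z) != 0.

Definition invariant_orders p (M : 'M[ratfun C]_p) z (nu : 'I_p -> int) : Prop :=
  (forall i j : 'I_p, (i <= j)%N -> nu i <= nu j) /\
  exists G1 G2 : 'M[ratfun C]_p,
    [/\ invertible_at G1 z, invertible_at G2 z &
        G1 *m M *m G2 = diag_mx (\row_i tofrac ('X - z%:P) ^ nu i)].

(* Negative orders are allowed: z may also be a pole of M. *)
Definition simple_zero p (M : 'M[ratfun C]_p) z : Prop :=
  exists nu : 'I_p -> int, invariant_orders M z nu /\
    exists i, nu i = 1 /\ forall j, 0 < nu j -> j = i.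

Definition right_root_vector p (M : 'M[ratfun C]_p) z (x : 'cV[ratfun C]_p) :
    Prop :=
  [/\ mx_no_pole x z, rmeval x z != 0 &
      rmeval (M *m x) t @[t --> z^'] --> (0 : 'cV[C]_p)].

Definition left_root_vector p (M : 'M[ratfun C]_p) z (y : 'cV[ratfun C]_p) :
    Prop :=
  [/\ mx_no_pole y z, rmeval y z != 0 &
      rmeval (y^T *m M) t @[t --> z^'] --> (0 : 'rV[C]_p)].

Definition eigenvector_at m (P : 'M[{poly C}]_m) z (v : 'cV[C]_m) : Prop :=
  v != 0 /\ pmeval P z *m v = 0.

Definition eigenvalue_at m (P : 'M[{poly C}]_m) z : Prop :=
  exists v, eigenvector_at P z v.

Definition vnorm2 n (v : 'cV[C]_n) : R := Num.sqrt (\sum_i cabs (v i 0) ^+ 2).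

Definition mnorm2 m n (M : 'M[C]_(m, n)) : R :=
  sup [set vnorm2 (M *m v) | v in [set v : 'cV[C]_n | vnorm2 v <= 1]].

End LocalStructure.

Section SystemMatrix.
Variable R : realType.
Local Notation C := R[i].
Variables n p : nat.

Definition system_mx (A : 'M[{poly C}]_n) (B : 'M[{poly C}]_(n, p))
    (Cm : 'M[{poly C}]_(p, n)) (D : 'M[{poly C}]_p) : 'M[{poly C}]_(n + p) :=
  block_mx (- A) B Cm D.

Definition transfer_fun (A : 'M[{poly C}]_n) (B : 'M[{poly C}]_(n, p))
    (Cm : 'M[{poly C}]_(p, n)) (D : 'M[{poly C}]_p) : 'M[ratfun C]_p :=
  ratmx D + ratmx Cm *m invmx (ratmx A) *m ratmx B.

Definition minimal_at (A : 'M[{poly C}]_n) (B : 'M[{poly C}]_(n, p))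
    (Cm : 'M[{poly C}]_(p, n)) (z : C) : Prop :=
  \rank (col_mx (- pmeval A z) (pmeval Cm z)) = n /\
  \rank (row_mx (pmeval A z) (pmeval B z)) = n.

End SystemMatrix.

Section ConditionNumber.
Variable R : realType.
Local Notation C := R[i].

(* [coefs_mx k M] is sum_(i <= k) M_i lambda^i. *)
Definition coefs_mx k m n (M : 'I_k.+1 -> 'M[C]_(m, n)) : 'M[{poly C}]_(m, n) :=
  \sum_(i < k.+1) 'X^i *: map_mx polyC (M i).

Definition size_bound k m n (M : 'M[{poly C}]_(m, n)) : Prop :=
  forall i j, (size (M i j) <= k.+1)%N.

Definition wsum k (a : 'I_k.+1 -> R) (z : C) : R :=
  \sum_(i < k.+1) a i * cabs z ^+ i.

Definition weight_mx kA kB kC kD (a : 'I_kA.+1 -> R) (b : 'I_kB.+1 -> R)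
    (c : 'I_kC.+1 -> R) (d : 'I_kD.+1 -> R) (z : C) : 'M[R]_(1 + 1) :=
  block_mx (wsum a z)%:M (wsum b z)%:M (wsum c z)%:M (wsum d z)%:M.

Definition isolating_radius m (P : 'M[{poly C}]_m) (z0 : C) (r : R) : Prop :=
  0 < r /\ forall mu, cabs (mu - z0) <= r -> eigenvalue_at P mu -> mu = z0.

(* The eigenvalue of a perturbation Q of P that arises from z0: the only one in
   the disc of radius r, where r is an isolating radius of z0 for P. *)
Definition perturbed_eigenvalue m (Q : 'M[{poly C}]_m) (z0 : C) (r : R)
    (mu : C) : Prop :=
  [/\ cabs (mu - z0) <= r, eigenvalue_at Q mu &
      forall mu', cabs (mu' - z0) <= r -> eigenvalue_at Q mu' -> mu' = mu].

(* The quotients |dz| / eps in the definition of the structured condition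
   number.  The vector v + eps dv is an eigenvector, hence nonzero. *)
Definition structured_quotients n p (P : 'M[{poly C}]_(n + p))
    kA kB kC kD (a : 'I_kA.+1 -> R) (b : 'I_kB.+1 -> R)
    (c : 'I_kC.+1 -> R) (d : 'I_kD.+1 -> R)
    (z0 : C) (v : 'cV[C]_(n + p)) (r eps : R) : set (\bar R) :=
  [set (cabs dz / eps)%:E | dz in [set dz : C |
    exists (dA : 'I_kA.+1 -> 'M[C]_n) (dB : 'I_kB.+1 -> 'M[C]_(n, p))
           (dC : 'I_kC.+1 -> 'M[C]_(p, n)) (dD : 'I_kD.+1 -> 'M[C]_p)
           (dv : 'cV[C]_(n + p)),
      let dP := system_mx (coefs_mx dA) (coefs_mx dB)
                          (coefs_mx dC) (coefs_mx dD) in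
      let Q := P + (eps%:C%C)%:P *: dP in
      [/\ forall i, mnorm2 (dA i) <= a i, forall i, mnorm2 (dB i) <= b i,
          forall i, mnorm2 (dC i) <= c i & forall i, mnorm2 (dD i) <= d i] /\
      perturbed_eigenvalue Q z0 r (z0 + dz) /\
      eigenvector_at Q (z0 + dz) (v + eps%:C%C *: dv)]].

(* kappa is the structured condition number of z0, defined with the right
   eigenvector v and the isolating radius r. *)
Definition structured_cond n p (P : 'M[{poly C}]_(n + p))
    kA kB kC kD (a : 'I_kA.+1 -> R) (b : 'I_kB.+1 -> R)
    (c : 'I_kC.+1 -> R) (d : 'I_kD.+1 -> R)
    (z0 : C) (v : 'cV[C]_(n + p)) (r : R) (kappa : \bar R) : Prop :=
  ereal_sup (structured_quotients P a b c d z0 v r eps) @[eps --> 0^'+]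
    --> kappa.

End ConditionNumber.

(* Main.v *)
Require Import Defs.
From mathcomp Require Import ring.

Set Implicit Arguments.
Unset Strict Implicit.
Unset Printing Implicit Defensive.

(** The theorem reduces to a perturbation statement about the system matrix [P]
    alone, with the kernel vectors of [P(z0)] computed from the root vectors.

    Let [u = A^-1 B x] and [w = y^T C A^-1].  The identities
    [P (u, x) = (0, R x)] and [(w, y^T) P = (0, y^T R)] hold over the rational
    functions, and minimality forces [u] and [w] to have no pole at [z0]
    ([state_no_pole], [costate_no_pole]).  The values [v0] and [w0] at [z0]
    of [(u, x)] and [(w, y^T)] are thus kernel vectors of [P(z0)].  The local Smith form of [R] at a simple
    zero says that root vectors are proportional at [z0] and that
    [y^T R x / (z - z0)] has a nonzero value there ([local_smith_root_vectors]).
    The first fact, together with the lifting of kernel vectors to root vectors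
    ([kernel_lift]), shows that the kernel of [P(z0)] is a line.  Since
    [y^T R x] equals the pairing of [(w, y^T)] and [(u, x)] through [P], the
    second one says that [w0 P'(z0) v0] is nonzero ([system_kernels]).  That
    number is also the limit of [y^T R' x], because
    [R(s) - R(t) = W(s) (P(s) - P(t)) V(t)] with [W = (C A^-1, 1)] and
    [V = (A^-1 B, 1)] ([transfer_diff], [transfer_derivative_limit]).  Hence
    [K = |w0 P'(z0) v0| > 0].

    For the perturbation, let [mu] be an eigenvalue of [P + eps E] in the
    isolating disc.  As [eps] tends to 0, [mu] tends to [z0]
    ([eigenvalue_localization]), and the bordering trick gives an eigenvector
    [u] that tends to [v0] ([ker_cvg]).  Multiplying [(P(mu) + eps E(mu)) u = 0]
    by [w0] on the left gives the exact identity
    [(mu - z0) (w0 P[mu, z0] u) = - eps (w0 E(mu) u)], in which [P[mu, z0]] is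
    the divided difference ([perturbation_identity]).  So [|mu - z0| / eps] is
    [|w0 E(mu) u|] divided by a quantity that tends to [K].  The numerator is at
    most the weighted form of the statement, evaluated at [mu] and [u]
    ([structured_form_le]), and a rank-one choice of each coefficient of [E]
    attains the form at [z0] ([structured_form_extremal]).  All limits are taken
    along a filter of triples (parameter, direction, eigenvalue), so that the
    upper bound is uniform in the direction.  The lower bound also needs the
    extremal direction to have exactly one eigenvalue in the disc: existence
    compares the determinant at [z0] and on the circle
    ([perturbed_eigenvalue_exists]), uniqueness pairs a left and a right
    eigenvector of two eigenvalues ([perturbed_eigenvalue_uniq]). *)

(** * Entrywise convergence of complex matrices *)

Section Convergence.
Variables (R : realType) (T : Type) (F : set_system T).
Context {FF : Filter F}.
Local Notation C := R[i].

(** Convergence of matrices is handled entry by entry, so that products,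
    determinants and inverses reduce to limits of complex numbers; [mcvgP]
    goes back to the topology of matrices. *)
Definition mcvg m n (M : T -> 'M[C]_(m, n)) (N : 'M[C]_(m, n)) : Prop :=
  forall i j, M t i j @[t --> F] --> N i j.

Lemma mcvgP m n (M : T -> 'M[C]_(m, n)) N :
  mcvg M N <-> M t @[t --> F] --> N.
Proof.
split=> [cv A [P NP PA]|cv i j A NA].
  apply: (@filterS _ F _ (fun t => forall i j, P i j (M t i j))).
    by move=> t Pt; exact: PA.
  apply: filter_forall => i; apply: filter_forall => j.
  exact: (cv i j _ (NP i j)).
apply: (cv [set X | A (X i j)]); exists (fun i' j' => [set x | (i', j') = (i, j) -> A x]).
  move=> i' j'; have [[-> ->]|ne] := pselect ((i', j') = (i, j)).
    by apply: filterS NA => x Ax _.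
  by apply: filterS filterT => x _ /ne.
by move=> X /(_ i j) /= ; apply.
Qed.

Lemma mcvg_near m n (M M' : T -> 'M[C]_(m, n)) N :
  (\forall t \near F, M t = M' t) -> mcvg M N -> mcvg M' N.
Proof.
move=> MM' cv i j; apply: cvg_trans (cv i j).
by apply: near_eq_cvg; apply: filterS MM' => t ->.
Qed.

Lemma mcvg_cst m n (N : 'M[C]_(m, n)) : mcvg (fun=> N) N.
Proof. by move=> i j; exact: cvg_cst. Qed.

Lemma mcvgD m n (M1 M2 : T -> 'M[C]_(m, n)) N1 N2 :
  mcvg M1 N1 -> mcvg M2 N2 -> mcvg (fun t => M1 t + M2 t) (N1 + N2).
Proof.
move=> c1 c2 i j; under eq_fun do rewrite mxE; rewrite mxE.
by apply: cvgD; [exact: c1|exact: c2].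
Qed.

Lemma mcvgZ m n (f : T -> C) (M : T -> 'M[C]_(m, n)) (a : C) N :
  f t @[t --> F] --> a -> mcvg M N -> mcvg (fun t => f t *: M t) (a *: N).
Proof.
move=> c1 c2 i j; under eq_fun do rewrite mxE; rewrite mxE.
by apply: cvgM; [exact: c1|exact: c2].
Qed.

Lemma mcvgT m n (M : T -> 'M[C]_(m, n)) N :
  mcvg M N -> mcvg (fun t => (M t)^T) N^T.
Proof. by move=> c i j; under eq_fun do rewrite mxE; rewrite mxE; exact: c. Qed.

Lemma cvg_sumC I (s : seq I) (P : pred I) (f : I -> T -> C) (l : I -> C) :
  (forall i, f i t @[t --> F] --> l i) ->
  \sum_(i <- s | P i) f i t @[t --> F] --> \sum_(i <- s | P i) l i.
Proof. by move=> cv; apply: cvg_big => //; exact: add_continuous. Qed.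

Lemma cvg_prodC I (s : seq I) (P : pred I) (f : I -> T -> C) (l : I -> C) :
  (forall i, f i t @[t --> F] --> l i) ->
  \prod_(i <- s | P i) f i t @[t --> F] --> \prod_(i <- s | P i) l i.
Proof. by move=> cv; apply: cvg_big => //; exact: mul_continuous. Qed.

Lemma mcvgM m n p (M1 : T -> 'M[C]_(m, n)) (M2 : T -> 'M[C]_(n, p)) N1 N2 :
  mcvg M1 N1 -> mcvg M2 N2 -> mcvg (fun t => M1 t *m M2 t) (N1 *m N2).
Proof.
move=> c1 c2 i j; under eq_fun do rewrite mxE; rewrite mxE.
by apply: cvg_sumC => k; apply: cvgM; [exact: c1|exact: c2].
Qed.

Lemma cvg_det n (M : T -> 'M[C]_n) N :
  mcvg M N -> \det (M t) @[t --> F] --> \det N.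
Proof.
move=> c; apply: cvg_sumC => s; apply: cvgM; first exact: cvg_cst.
by apply: cvg_prodC => i; exact: c.
Qed.

Lemma mcvg_row m n1 n2 (M1 : T -> 'M[C]_(m, n1)) (M2 : T -> 'M[C]_(m, n2)) N1 N2 :
  mcvg M1 N1 -> mcvg M2 N2 ->
  mcvg (fun t => row_mx (M1 t) (M2 t)) (row_mx N1 N2).
Proof.
move=> c1 c2 i j; rewrite mxE; under eq_fun do rewrite mxE.
by case: (fintype.split j) => j'; [exact: c1|exact: c2].
Qed.

Lemma mcvg_col m1 m2 n (M1 : T -> 'M[C]_(m1, n)) (M2 : T -> 'M[C]_(m2, n)) N1 N2 :
  mcvg M1 N1 -> mcvg M2 N2 ->
  mcvg (fun t => col_mx (M1 t) (M2 t)) (col_mx N1 N2).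
Proof.
move=> c1 c2 i j; rewrite mxE; under eq_fun do rewrite mxE.
by case: (fintype.split i) => i'; [exact: c1|exact: c2].
Qed.

Lemma near_neq0 (f : T -> C) (a : C) : f t @[t --> F] --> a -> a != 0 ->
  \forall t \near F, f t != 0.
Proof.
exact: cvgr_neq0.
Qed.

Lemma near_unitmx n (M : T -> 'M[C]_n) N :
  mcvg M N -> N \in unitmx -> \forall t \near F, M t \in unitmx.
Proof.
move=> c uN; have := near_neq0 (cvg_det c); rewrite -unitfE => /(_ uN).
by apply: filterS => t; rewrite -unitfE.
Qed.

(** The inverse is the adjugate divided by the determinant as soon as the
    determinant is nonzero, hence near the limit. *)
Lemma mcvg_inv n (M : T -> 'M[C]_n) N :
  mcvg M N -> N \in unitmx -> mcvg (fun t => invmx (M t)) (invmx N).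
Proof.
move=> c uN; have uM := near_unitmx c uN.
apply: (@mcvg_near _ _ (fun t => (\det (M t))^-1 *: \adj (M t))).
  by apply: filterS uM => t ut; rewrite /invmx ut.
rewrite /invmx uN; apply: mcvgZ.
  by apply: cvgV (cvg_det c); rewrite -unitfE.
move=> i j; under eq_fun do rewrite mxE; rewrite mxE.
apply: cvgM; first exact: cvg_cst.
by apply: cvg_det => k l; under eq_fun do rewrite !mxE; rewrite !mxE; exact: c.
Qed.

Lemma cvg_cabs (f : T -> C) (a : C) : f t @[t --> F] --> a ->
  cabs (f t) @[t --> F] --> cabs a.
Proof.
move=> /cvgrPdist_lt cv; apply/cvgrPdist_lt => e e0.
have := cv e%:C%C; rewrite ltcR => /(_ e0); apply: filterS => t.
have nE (z : C) : `|z| = (cabs z)%:C%C by case: z.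
rewrite nE ltcR; apply: le_lt_trans.
have sub (z w : C) : cabs z - cabs w <= cabs (z - w).
  by rewrite lerBlDr -{1}(subrK w z); exact: le_normcD.
rewrite ler_norml sub andbT lerNl opprB.
by rewrite -[cabs (a - _)]normcN opprB; exact: sub.
Qed.

Lemma cabs_cvg0 (f : T -> C) : cabs (f t) @[t --> F] --> 0 ->
  f t @[t --> F] --> 0.
Proof.
move=> /cvgr0Pnorm_lt cv; apply/cvgr0Pnorm_lt => -[e e'] /[!ltcE] /= /andP[/eqP -> e0].
have := cv e e0; apply: filterS => t.
have nE (z : C) : `|z| = (cabs z)%:C%C by case: z.
have g0 : 0 <= cabs (f t) by case: (f t) => ? ?; exact: sqrtr_ge0.
by rewrite nE ltcR ger0_norm.
Qed.

Lemma cvg_horner (q : {poly C}) (mu : T -> C) (z : C) :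
  mu t @[t --> F] --> z -> q.[mu t] @[t --> F] --> q.[z].
Proof.
move=> cv.
have qE x : q.[x] = \sum_(i < size q) q`_i * \prod_(j < i) x.
  by rewrite horner_coef; apply: eq_bigr => i _; rewrite prodr_const card_ord.
rewrite qE; under eq_fun do rewrite qE.
apply: cvg_sumC => i; apply: cvgM; first exact: cvg_cst.
exact: cvg_prodC.
Qed.

Lemma mcvg_pmeval m n (P : 'M[{poly C}]_(m, n)) (mu : T -> C) (z : C) :
  mu t @[t --> F] --> z -> mcvg (fun t => pmeval P (mu t)) (pmeval P z).
Proof.
move=> cv i j; under eq_fun do rewrite !mxE; rewrite !mxE; exact: cvg_horner.
Qed.

End Convergence.

Arguments cvg_horner {R T F FF} q {mu z}.

(** * The modulus and the location of polynomial roots *)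

Section Modulus.
Variable R : realType.
Local Notation C := R[i].
Implicit Types z w : C.

Lemma cabs_ge0 z : 0 <= cabs z.
Proof. by case: z => ? ?; exact: sqrtr_ge0. Qed.

Lemma cabs_eq0 z : (cabs z == 0) = (z == 0).
Proof.
by apply/eqP/eqP => [/Normc.eq0_normc//|->]; exact: Normc.normc0.
Qed.

Lemma cabs_gt0 z : (0 < cabs z) = (z != 0).
Proof. by rewrite lt0r cabs_ge0 andbT cabs_eq0. Qed.

Lemma cabsN z : cabs (- z) = cabs z.
Proof. exact: normcN. Qed.

Lemma cabsD z w : cabs (z + w) <= cabs z + cabs w.
Proof. exact: le_normcD. Qed.

Lemma cabsB z w : cabs z - cabs w <= cabs (z - w).
Proof. by rewrite lerBlDr -{1}(subrK w z) cabsD. Qed.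

Lemma cabsX z k : cabs (z ^+ k) = cabs z ^+ k.
Proof.
elim: k => [|k IH]; first by rewrite !expr0 Normc.normc1.
by rewrite !exprS Normc.normcM IH.
Qed.

Lemma cabs_real (a : R) : cabs a%:C%C = `|a|.
Proof. by rewrite /= expr0n addr0 sqrtr_sqr. Qed.

Lemma cabs_sum I (s : seq I) (P : pred I) (f : I -> C) :
  cabs (\sum_(i <- s | P i) f i) <= \sum_(i <- s | P i) cabs (f i).
Proof.
elim/big_rec2: _ => [|i y x _ le]; first by rewrite Normc.normc0.
by apply: le_trans (cabsD _ _) _; rewrite lerD2l.
Qed.

End Modulus.

Section RootLocation.
Variable R : realType.
Local Notation C := R[i].

(** Factor [q] into linear factors: a root in the disc is [z0], at distance at
    least [tau] from [mu], and a root outside the closed disc stays at a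
    distance bounded away from the disc.  This replaces a compactness argument
    on the annulus. *)
Lemma poly_lower_bound (q : {poly C}) (z0 : C) (r tau : R) :
  q != 0 -> 0 < tau ->
  (forall mu, cabs (mu - z0) <= r -> root q mu -> mu = z0) ->
  exists2 c0 : R, 0 < c0 & forall mu, tau <= cabs (mu - z0) ->
    cabs (mu - z0) <= r -> c0 <= cabs q.[mu].
Proof.
move=> q0 tau0; have [rs ->] := closed_field_poly_normal q.
set l := lead_coef q; have l0 : l != 0 by rewrite lead_coef_eq0.
move=> iso.
have {}iso s : s \in rs -> cabs (s - z0) <= r -> s = z0.
  move=> srs sr; apply: iso => //; rewrite rootZ//.
  by rewrite root_prod_XsubC.
suff [c0 c00 H] : exists2 c0 : R, 0 < c0 & forall mu, tau <= cabs (mu - z0) ->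
    cabs (mu - z0) <= r -> c0 <= cabs (\prod_(z <- rs) ('X - z%:P)).[mu].
  exists (cabs l * c0); first by rewrite mulr_gt0// cabs_gt0.
  move=> mu h1 h2; rewrite hornerZ Normc.normcM ler_wpM2l ?cabs_ge0//.
  exact: H.
elim: rs iso => [|s rs IH] iso.
  exists 1 => // mu _ _; rewrite big_nil hornerC Normc.normc1; exact: lexx.
have [|c0 c00 H] := IH.
  by move=> s' s'rs; apply: iso; rewrite in_cons s'rs orbT.
have [d d0 Hd] : exists2 d : R, 0 < d & forall mu, tau <= cabs (mu - z0) ->
    cabs (mu - z0) <= r -> d <= cabs (mu - s).
  have [sr|sr] := leP (cabs (s - z0)) r.
    by exists tau => // mu; rewrite (iso s) ?mem_head.
  exists (cabs (s - z0) - r); first by rewrite subr_gt0.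
  move=> mu _ mur; rewrite -[cabs (mu - s)]cabsN opprB.
  have -> : s - mu = (s - z0) - (mu - z0) by ring.
  by apply: le_trans (cabsB _ _); rewrite lerB.
exists (d * c0); first exact: mulr_gt0.
move=> mu h1 h2; rewrite big_cons hornerM hornerXsubC Normc.normcM.
by apply: ler_pM; [exact: ltW|exact: ltW|exact: Hd|exact: H].
Qed.

(** Moving the argument from [z0] to [z0 + r] at most doubles its distance to a
    root that is at distance at least [r] from [z0]; without a root in the disc
    the modulus of [q] would therefore grow by a factor at most [2 ^ deg q].
    This produces eigenvalues of perturbed matrices, in the place of Rouche's
    theorem. *)
Lemma poly_root_in_disc (q : {poly C}) (z0 : C) (r : R) (N : nat) :
  0 < r -> (size q <= N.+1)%N ->
  2 ^+ N * cabs q.[z0] < cabs q.[z0 + r%:C%C] ->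
  exists2 mu, cabs (mu - z0) <= r & root q mu.
Proof.
move=> r0 sq lt; apply: contrapT => no.
have {}no s : root q s -> r <= cabs (s - z0).
  by move=> rt; rewrite leNgt; apply/negP => /ltW sr; apply: no; exists s.
move: lt; apply/negP; rewrite -leNgt.
have [->|q0] := eqVneq q 0.
  by rewrite !horner0 Normc.normc0 mulr0.
have [rs qE] := closed_field_poly_normal q.
have l0 : lead_coef q != 0 by rewrite lead_coef_eq0.
have szrs : (size rs <= N)%N.
  by move: sq; rewrite qE size_scale// size_prod_XsubC ltnS.
have {}no s : s \in rs -> r <= cabs (s - z0).
  by move=> srs; apply: no; rewrite qE rootZ// root_prod_XsubC.
have : cabs q.[z0 + r%:C%C] <= 2 ^+ size rs * cabs q.[z0].
  rewrite qE !hornerZ !Normc.normcM mulrCA ler_wpM2l ?cabs_ge0//.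
  elim: rs no {szrs qE} => [|s rs IH] no.
    by rewrite !big_nil !hornerC !Normc.normc1 mul1r.
  rewrite !big_cons !hornerM !hornerXsubC !Normc.normcM /= exprS mulrACA.
  apply: ler_pM; rewrite ?cabs_ge0//; last first.
    by apply: IH => s' s'rs; apply: no; rewrite in_cons s'rs orbT.
  rewrite addrAC; apply: le_trans (cabsD _ _) _.
  rewrite cabs_real gtr0_norm// mulr2n mulrDl mul1r lerD2l.
  by rewrite -cabsN opprB no ?mem_head.
move/le_trans; apply; rewrite ler_wpM2r ?cabs_ge0//.
by apply: ler_weXn2l; rewrite ?ler1n.
Qed.

End RootLocation.

(** * Divided differences of polynomial matrices *)

Section DividedDifference.
Variable R : realType.
Local Notation C := R[i].

(** The divided difference of [q], continuous in both points.  It turns increments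
    into exact products, and on the diagonal [s = t] it is the derivative. *)
Definition ddiff (q : {poly C}) (s t : C) : C :=
  \sum_(i < size q) q`_i * \sum_(j < i) s ^+ (i.-1 - j) * t ^+ j.

Lemma ddiffE q s t : q.[s] - q.[t] = (s - t) * ddiff q s t.
Proof.
rewrite !horner_coef -sumrB /ddiff mulr_sumr; apply: eq_bigr => i _.
by rewrite -mulrBr subrXX mulrCA.
Qed.

Definition mddiff m n (P : 'M[{poly C}]_(m, n)) s t : 'M[C]_(m, n) :=
  map_mx (fun q => ddiff q s t) P.

Lemma mddiffE m n (P : 'M[{poly C}]_(m, n)) s t :
  pmeval P s - pmeval P t = (s - t) *: mddiff P s t.
Proof. by apply/matrixP => i j; rewrite !mxE ddiffE. Qed.

Lemma cvg_ddiff (T : Type) (F : set_system T) {FF : Filter F}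
    (q : {poly C}) (mu1 mu2 : T -> C) (z1 z2 : C) :
  mu1 t @[t --> F] --> z1 -> mu2 t @[t --> F] --> z2 ->
  ddiff q (mu1 t) (mu2 t) @[t --> F] --> ddiff q z1 z2.
Proof.
move=> c1 c2; apply: cvg_sumC => k; apply: cvgM; first exact: cvg_cst.
apply: cvg_sumC => l.
have cvgX (f : T -> C) (x : C) e : f t @[t --> F] --> x ->
    f t ^+ e @[t --> F] --> x ^+ e.
  move=> cf; have XE y : y ^+ e = ('X^e : {poly C}).[y] by rewrite hornerXn.
  by rewrite XE; under eq_fun do rewrite XE; exact: cvg_horner.
by apply: cvgM; exact: cvgX.
Qed.

Lemma mcvg_mddiff (T : Type) (F : set_system T) {FF : Filter F} m n
    (P : 'M[{poly C}]_(m, n)) (mu1 mu2 : T -> C) (z1 z2 : C) :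
  mu1 t @[t --> F] --> z1 -> mu2 t @[t --> F] --> z2 ->
  mcvg F (fun t => mddiff P (mu1 t) (mu2 t)) (mddiff P z1 z2).
Proof.
by move=> c1 c2 i j; under eq_fun do rewrite mxE; rewrite mxE; exact: cvg_ddiff.
Qed.

End DividedDifference.

(** * Kernels of nearly singular matrices *)

Section Bordering.
Variable (K : fieldType).

Lemma ker0_unitmx m (M : 'M[K]_m) :
  (forall u : 'cV_m, M *m u = 0 -> u = 0) -> M \in unitmx.
Proof.
move=> ker0; rewrite -unitmx_tr -row_free_unit; apply: inj_row_free => u uM.
by apply: trmx_inj; rewrite trmx0; apply: ker0; apply: trmx_inj;
  rewrite trmx_mul trmxK uM trmx0.
Qed.

Lemma unitmx_ker0 m (M : 'M[K]_m) (u : 'cV_m) :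
  M \in unitmx -> M *m u = 0 -> u = 0.
Proof. by move=> uM Mu; rewrite -(mulKmx uM u) Mu mulmx0. Qed.

Lemma det0_ker m (M : 'M[K]_m) : \det M = 0 <-> exists2 u : 'cV_m, u != 0 & M *m u = 0.
Proof.
rewrite -det_tr; split=> [/eqP/det0P[u u0 uM]|[u u0 Mu]].
  exists u^T; first by rewrite -(inj_eq (@trmx_inj _ _ _)) trmxK trmx0.
  by apply: trmx_inj; rewrite trmx_mul trmxK uM trmx0.
apply/eqP/det0P; exists u^T; first by rewrite -(inj_eq (@trmx_inj _ _ _)) trmxK trmx0.
by rewrite -trmx_mul Mu trmx0.
Qed.

Lemma dual_vector m (u : 'cV[K]_m) : u != 0 -> exists f : 'rV_m, f *m u = 1%:M.
Proof.
case/cV0Pn => i ui; exists ((u i 0)^-1 *: delta_mx 0 i).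
by rewrite -scalemxAl -rowE; apply/matrixP => j k; rewrite !ord1 !mxE mulVf.
Qed.

Definition simple_ker m (P : 'M[K]_m) (v : 'cV_m) : Prop :=
  [/\ v != 0, P *m v = 0 & forall u : 'cV_m, P *m u = 0 -> exists a, u = a *: v].

(** Adding a rank-one matrix that pairs nontrivially with the left and right
    kernel vectors removes a one-dimensional kernel. *)
Lemma bordering m (P : 'M[K]_m) (v : 'cV_m) (w : 'rV_m) :
  simple_ker P v -> w != 0 -> w *m P = 0 ->
  exists (al : 'cV_m) (be : 'rV_m),
    [/\ be *m v = 1%:M, w *m al = 1%:M & P + al *m be \in unitmx].
Proof.
move=> [v0 Pv kerP] w0 wP.
have [be bev] := dual_vector v0.
have [|f fw] := @dual_vector _ w^T.
  by rewrite -(inj_eq (@trmx_inj _ _ _)) trmxK trmx0.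
have wf : w *m f^T = 1%:M by rewrite -[w]trmxK -trmx_mul fw trmx1.
exists f^T, be; split=> //; apply: ker0_unitmx => u Mu.
have beu : be *m u = 0.
  have := congr1 (mulmx w) Mu.
  by rewrite mulmx0 mulmxDl mulmxDr mulmxA wP mul0mx add0r !mulmxA wf mul1mx.
have [|a ua] := kerP u.
  by move: Mu; rewrite mulmxDl -mulmxA beu mulmx0 addr0.
move: beu; rewrite ua -scalemxAr bev => /matrixP/(_ 0 0).
by rewrite !mxE mulr1 => ->; rewrite scale0r.
Qed.

(** The bordered matrix sends both [w] and any other left kernel vector to
    multiples of [be]; as it is invertible, they are proportional. *)
Lemma simple_ker_tr m (P : 'M[K]_m) (v : 'cV_m) (w : 'rV_m) :
  simple_ker P v -> w != 0 -> w *m P = 0 -> simple_ker P^T w^T.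
Proof.
move=> sP w0 wP; have [al [be [bev wal uM]]] := bordering sP w0 wP.
split; first by rewrite -(inj_eq (@trmx_inj _ _ _)) trmxK trmx0.
  by rewrite -trmx_mul wP trmx0.
move=> u Pu; have {}Pu : u^T *m P = 0.
  by apply: trmx_inj; rewrite trmx_mul trmxK Pu trmx0.
exists ((u^T *m al) 0 0); apply: trmx_inj; rewrite linearZ /= trmxK.
apply: (can_inj (mulmxK uM)); rewrite -scalemxAl !mulmxDr Pu wP !add0r !mulmxA.
by rewrite wal mul1mx {1}[_ *m al]mx11_scalar mul_scalar_mx.
Qed.

End Bordering.

Section KernelContinuity.
Variables (R : realType) (T : Type) (F : set_system T).
Context {FF : Filter F}.
Local Notation C := R[i].

(** When [Q t] is singular its kernel contains [M^-1 al], where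
    [M = Q t + al be] is the bordered matrix: a kernel vector [x] of [Q t]
    satisfies [M x = (be x) al], and [be x] is nonzero because [M] is
    invertible.  This formula is continuous in [Q t]. *)
Lemma ker_cvg m (P : 'M[C]_m) (v : 'cV_m) (w : 'rV_m) (Q : T -> 'M[C]_m) :
  simple_ker P v -> w != 0 -> w *m P = 0 -> mcvg F Q P ->
  (\forall t \near F, \det (Q t) = 0) ->
  exists2 u : T -> 'cV[C]_m, mcvg F u v & \forall t \near F, Q t *m u t = 0.
Proof.
move=> sP w0 wP cQ dQ; have [al [be [bev wal uM]]] := bordering sP w0 wP.
have [v0 Pv _] := sP.
have cM : mcvg F (fun t => Q t + al *m be) (P + al *m be).
  by apply: mcvgD; [exact: cQ|exact: mcvg_cst].
exists (fun t => invmx (Q t + al *m be) *m al).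
  have -> : v = invmx (P + al *m be) *m al.
    apply: (can_inj (mulKmx uM)); rewrite mulKVmx// mulmxDl Pv add0r.
    by rewrite -mulmxA bev mulmx1.
  by apply: mcvgM; [exact: mcvg_inv|exact: mcvg_cst].
near=> t.
have /det0_ker[x x0 Qx] : \det (Q t) = 0 by near: t.
have uMt : Q t + al *m be \in unitmx by near: t; exact: near_unitmx cM uM.
set s := (be *m x) 0 0.
have Mx : (Q t + al *m be) *m x = s *: al.
  by rewrite mulmxDl Qx add0r -mulmxA [be *m x]mx11_scalar mul_mx_scalar.
have s0 : s != 0.
  apply: contra_neq x0 => s0; apply: unitmx_ker0 uMt _.
  by rewrite Mx s0 scale0r.
have xE : x = s *: (invmx (Q t + al *m be) *m al).
  by rewrite scalemxAr -Mx mulKmx.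
move: Qx; rewrite xE -scalemxAr => /eqP; rewrite scaler_eq0 (negPf s0) /=.
by move/eqP.
Unshelve. all: by end_near. Qed.

(** Boundedness makes this asymptotic equality compatible with products, hence
    with determinants, although neither function needs to converge: nothing is
    known about the limit of the eigenvalue when it is used. *)
Definition close (f g : T -> C) : Prop :=
  [/\ exists M : R, \forall t \near F, cabs (f t) <= M,
      exists M : R, \forall t \near F, cabs (g t) <= M &
      f t - g t @[t --> F] --> (0 : C)].

Lemma close_cst (c : C) : close (fun=> c) (fun=> c).
Proof.
split; [exists (cabs c)|exists (cabs c)|].
- by apply: filterS filterT.
- by apply: filterS filterT.
- by under eq_fun do rewrite subrr; exact: cvg_cst.
Qed.

Lemma bounded_cvg0 (f g : T -> C) :
  (exists M : R, \forall t \near F, cabs (f t) <= M) ->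
  g t @[t --> F] --> (0 : C) -> f t * g t @[t --> F] --> (0 : C).
Proof.
move=> [M bM] /cvg_cabs; rewrite Normc.normc0 => /cvgr0Pnorm_lt cg.
apply: cabs_cvg0; apply/cvgr0Pnorm_lt => e e0.
have M1 : 0 < `|M| + 1 by rewrite ltr_pwDr.
near=> t.
have h1 : cabs (f t) <= M by near: t.
have h2 : `|cabs (g t)| < e / (`|M| + 1) by near: t; apply: cg; exact: divr_gt0.
rewrite Normc.normcM normrM; move: h2; rewrite ltr_pdivlMr// mulrC.
apply: le_lt_trans; rewrite ler_wpM2r// ger0_norm ?cabs_ge0//.
by rewrite (le_trans h1)// (le_trans (ler_norm _))// lerDl.
Unshelve. all: by end_near. Qed.

Lemma closeD f1 g1 f2 g2 : close f1 g1 -> close f2 g2 ->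
  close (fun t => f1 t + f2 t) (fun t => g1 t + g2 t).
Proof.
have bD f g : (exists M : R, \forall t \near F, cabs (f t) <= M) ->
    (exists M : R, \forall t \near F, cabs (g t) <= M) ->
    exists M : R, \forall t \near F, cabs (f t + g t) <= M.
  move=> [M1 b1] [M2 b2]; exists (M1 + M2); near=> t.
  by rewrite (le_trans (cabsD _ _))// lerD//; near: t.
move=> [b1 b1' c1] [b2 b2' c2]; split; [exact: bD|exact: bD|].
rewrite -(addr0 0); under eq_fun do rewrite opprD addrACA.
exact: cvgD.
Unshelve. all: by end_near. Qed.

Lemma closeM f1 g1 f2 g2 : close f1 g1 -> close f2 g2 ->
  close (fun t => f1 t * f2 t) (fun t => g1 t * g2 t).
Proof.
have bM f g : (exists M : R, \forall t \near F, cabs (f t) <= M) ->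
    (exists M : R, \forall t \near F, cabs (g t) <= M) ->
    exists M : R, \forall t \near F, cabs (f t * g t) <= M.
  move=> [M1 b1] [M2 b2]; exists (M1 * M2); near=> t.
  by rewrite Normc.normcM ler_pM ?cabs_ge0//; near: t.
move=> [b1 b1' c1] [b2 b2' c2]; split; [exact: bM|exact: bM|].
have E t : f1 t * f2 t - g1 t * g2 t
   = f1 t * (f2 t - g2 t) + g2 t * (f1 t - g1 t) by ring.
under eq_fun do rewrite E; rewrite -(addr0 0).
by apply: cvgD; exact: bounded_cvg0.
Unshelve. all: by end_near. Qed.

Lemma close_sum I (s : seq I) (P : pred I) (f g : I -> T -> C) :
  (forall i, close (f i) (g i)) ->
  close (fun t => \sum_(i <- s | P i) f i t) (fun t => \sum_(i <- s | P i) g i t).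
Proof.
move=> cl; elim: s => [|i s IH].
  by under eq_fun do rewrite big_nil;
    under [X in close _ X]eq_fun do rewrite big_nil; exact: close_cst.
under eq_fun do rewrite big_cons; under [X in close _ X]eq_fun do rewrite big_cons.
by case: (P i) => //; exact: closeD.
Qed.

Lemma close_prod I (s : seq I) (P : pred I) (f g : I -> T -> C) :
  (forall i, close (f i) (g i)) ->
  close (fun t => \prod_(i <- s | P i) f i t) (fun t => \prod_(i <- s | P i) g i t).
Proof.
move=> cl; elim: s => [|i s IH].
  by under eq_fun do rewrite big_nil;
    under [X in close _ X]eq_fun do rewrite big_nil; exact: close_cst.
under eq_fun do rewrite big_cons; under [X in close _ X]eq_fun do rewrite big_cons.
by case: (P i) => //; exact: closeM.
Qed.

Lemma close_det m (M N : T -> 'M[C]_m) :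
  (forall i j, close (fun t => M t i j) (fun t => N t i j)) ->
  close (fun t => \det (M t)) (fun t => \det (N t)).
Proof.
move=> cl; apply: close_sum => s; apply: closeM; first exact: close_cst.
by apply: close_prod => i; exact: cl.
Qed.

Lemma bounded_horner (q : {poly C}) (z0 : C) (r : R) :
  exists M : R, forall mu : C, cabs (mu - z0) <= r -> cabs q.[mu] <= M.
Proof.
elim/poly_ind: q => [|q c [M IH]].
  by exists 0 => mu _; rewrite horner0 Normc.normc0; exact: lexx.
exists (M * (r + cabs z0) + cabs c) => mu mur; rewrite hornerMXaddC.
apply: le_trans (cabsD _ _) _; rewrite lerD2r Normc.normcM.
apply: ler_pM; rewrite ?cabs_ge0 ?IH//.
by rewrite -{1}(subrK z0 mu) (le_trans (cabsD _ _))// lerD2r.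
Qed.

(** Since [det (P + X)] vanishes and [X] tends to 0 while [mu] stays bounded,
    [det P] tends to 0 along [mu]; but [det P] is bounded below on every
    annulus around its only root in the disc. *)
Lemma eigenvalue_localization m (P : 'M[{poly C}]_m) (z0 : C) (r : R)
    (mu : T -> C) (X : T -> 'M[C]_m) :
  \det P != 0 -> isolating_radius P z0 r ->
  mcvg F X 0 -> (\forall t \near F, cabs (mu t - z0) <= r) ->
  (\forall t \near F, \det (pmeval P (mu t) + X t) = 0) ->
  mu t @[t --> F] --> z0.
Proof.
move=> P0 [r0 iso] cX mur dX.
have detE z : \det (pmeval P z) = (\det P).[z].
  by rewrite -horner_evalE -det_map_mx; congr (\det _).
have [_ _] : close (fun t => \det (pmeval P (mu t) + X t))
                   (fun t => \det (pmeval P (mu t))).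
  apply: close_det => i j; have [M bM] := bounded_horner (P i j) z0 r.
  have bM' : \forall t \near F, cabs ((pmeval P (mu t)) i j) <= M.
    by apply: filterS mur => t /bM; rewrite mxE.
  have cX' : X t i j @[t --> F] --> (0 : C) by have := cX i j; rewrite mxE.
  split; [exists (M + 1)|by exists M|].
    have c0' : cabs (X t i j) @[t --> F] --> (0 : R).
      by rewrite -(Normc.normc0 R); exact: cvg_cabs.
    have /cvgr0Pnorm_lt H1 := c0'; have X1 := H1 _ ltr01.
    near=> t; rewrite mxE (le_trans (cabsD _ _))// lerD//; first by near: t.
    rewrite (le_trans (ler_norm _))//; apply: ltW.
    by near: t.
  have E t : (pmeval P (mu t) + X t) i j - pmeval P (mu t) i j = X t i j.
    by rewrite !mxE addrC addKr.
  by under eq_fun do rewrite E.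
move=> cvd; apply/cvgrPdist_lt => -[e e'] /[!ltcE] /= /andP[/eqP -> e0].
have nE (z : C) : `|z| = (cabs z)%:C%C by case: z.
have [|||c0 c00 H] := @poly_lower_bound R (\det P) z0 r e => //.
  move=> z zr rt; apply: iso => //; rewrite /eigenvalue_at.
  have /det0_ker[u u0 Pu] : \det (pmeval P z) = 0 by rewrite detE; exact/rootP.
  by exists u.
have c0' : cabs (\det (pmeval P (mu t) + X t) - \det (pmeval P (mu t)))
    @[t --> F] --> (0 : R) by rewrite -(Normc.normc0 R); exact: cvg_cabs.
have /cvgr0Pnorm_lt H1 := c0'; have small := H1 _ c00.
near=> t; rewrite nE ltcR -cabsN opprB ltNge; apply/negP => et.
have : `|cabs (\det (pmeval P (mu t) + X t) - \det (pmeval P (mu t)))| < c0.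
  by near: t.
rewrite (_ : \det (pmeval P (mu t) + X t) = 0); last by near: t.
rewrite sub0r cabsN detE ger0_norm ?cabs_ge0// ltNge H//.
by near: t.
Unshelve. all: by end_near. Qed.

End KernelContinuity.

(** * The Euclidean norm and the spectral norm *)

Section Norms.
Variable R : realType.
Local Notation C := R[i].

Lemma cauchy_schwarz_sum n (a b : 'I_n -> R) :
  (\sum_i a i * b i) ^+ 2 <= (\sum_i a i ^+ 2) * \sum_i b i ^+ 2.
Proof.
set S := \sum_i _; set A := \sum_i _; set B := \sum_i _.
have B0 : 0 <= B by apply: sumr_ge0 => i _; exact: sqr_ge0.
have [B_eq0|Bn0] := eqVneq B 0.
  have b0 i : b i = 0.
    have /psumr_eq0P : B = 0 by []; move=> /(_ (fun i _ => sqr_ge0 _))/(_ i isT).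
    by move/eqP; rewrite sqrf_eq0 => /eqP.
  by rewrite B_eq0 mulr0 /S big1 ?expr0n// => i _; rewrite b0 mulr0.
have Bp : 0 < B by rewrite lt0r Bn0.
rewrite -subr_ge0 -(pmulr_rge0 _ Bp).
have -> : B * (A * B - S ^+ 2) = \sum_i (a i * B - b i * S) ^+ 2.
  have sumE (c1 c2 c3 : R) : \sum_i (c1 * a i ^+ 2 + c2 * (a i * b i) + c3 * b i ^+ 2)
      = c1 * A + c2 * S + c3 * B by rewrite !big_split /= -!mulr_sumr.
  transitivity (B ^+ 2 * A + (- (B * S *+ 2)) * S + S ^+ 2 * B); first by ring.
  by rewrite -sumE; apply: eq_bigr => i _; ring.
by apply: sumr_ge0 => i _; exact: sqr_ge0.
Qed.

Lemma vnorm2_ge0 n (v : 'cV[C]_n) : 0 <= vnorm2 v.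
Proof. exact: sqrtr_ge0. Qed.

Lemma vnorm2_sqr n (v : 'cV[C]_n) : vnorm2 v ^+ 2 = \sum_i cabs (v i 0) ^+ 2.
Proof. by rewrite sqr_sqrtr// sumr_ge0// => i _; exact: sqr_ge0. Qed.

Lemma vnorm2Z n a (v : 'cV[C]_n) : vnorm2 (a *: v) = cabs a * vnorm2 v.
Proof.
apply/eqP; rewrite -(@eqrXn2 _ 2)// ?mulr_ge0 ?cabs_ge0 ?vnorm2_ge0//.
rewrite exprMn !vnorm2_sqr mulr_sumr; apply/eqP.
by apply: eq_bigr => i _; rewrite mxE Normc.normcM exprMn.
Qed.

Lemma vnorm2_0 n : vnorm2 (0 : 'cV[C]_n) = 0.
Proof. by rewrite -(scale0r 0) vnorm2Z Normc.normc0 mul0r. Qed.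

Lemma vnorm2_eq0 n (v : 'cV[C]_n) : vnorm2 v = 0 -> v = 0.
Proof.
move=> v0; have := vnorm2_sqr v; rewrite v0 expr0n /= => /esym/psumr_eq0P H.
apply/matrixP => i j; rewrite ord1 mxE; apply/eqP.
have /eqP := H (fun i _ => sqr_ge0 _) i isT.
by rewrite sqrf_eq0 cabs_eq0.
Qed.

Lemma cabs_dot_le n (w : 'rV[C]_n) (v : 'cV[C]_n) :
  cabs ((w *m v) 0 0) <= vnorm2 w^T * vnorm2 v.
Proof.
rewrite mxE; apply: le_trans (cabs_sum _ _ _) _.
under eq_bigr do rewrite Normc.normcM.
rewrite -(@ler_pXn2r _ 2)// ?nnegrE ?sumr_ge0 ?mulr_ge0 ?vnorm2_ge0//; last first.
  by move=> i _; rewrite mulr_ge0 ?cabs_ge0.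
rewrite exprMn !vnorm2_sqr; under [X in _ <= X * _]eq_bigr do rewrite mxE.
exact: cauchy_schwarz_sum.
Qed.

Section OperatorNorm.
Variables (m n : nat) (M : 'M[C]_(m, n)).

Let ball_values := [set vnorm2 (M *m v) | v in [set v : 'cV[C]_n | vnorm2 v <= 1]].

Lemma vnorm2_mulmx_bounded : exists c : R, forall v, vnorm2 (M *m v) <= c * vnorm2 v.
Proof.
exists (Num.sqrt (\sum_i vnorm2 (row i M)^T ^+ 2)) => v.
have s0 : 0 <= \sum_i vnorm2 (row i M)^T ^+ 2.
  by apply: sumr_ge0 => i _; exact: sqr_ge0.
rewrite -(@ler_pXn2r _ 2)// ?nnegrE ?mulr_ge0 ?vnorm2_ge0 ?sqrtr_ge0//.
rewrite (vnorm2_sqr (M *m v)) exprMn sqr_sqrtr// mulr_suml; apply: ler_sum => i _.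
rewrite -exprMn ler_pXn2r ?nnegrE ?mulr_ge0 ?vnorm2_ge0 ?cabs_ge0//.
apply: le_trans (cabs_dot_le (row i M) v).
by rewrite -row_mul [row _ _ _ _]mxE.
Qed.

Lemma mnorm2_has_sup : has_sup ball_values.
Proof.
split.
  by exists (vnorm2 (M *m 0)); exists 0 => //=; rewrite vnorm2_0.
have [c bc] := vnorm2_mulmx_bounded; exists `|c| => _ [v /= v1 <-].
apply: le_trans (bc v) _; apply: le_trans (_ : `|c| * vnorm2 v <= _).
  by rewrite ler_wpM2r ?vnorm2_ge0// ler_norm.
by rewrite ler_piMr.
Qed.

Lemma mnorm2_ge v : vnorm2 v <= 1 -> vnorm2 (M *m v) <= mnorm2 M.
Proof. by move=> v1; apply: ub_le_sup; [case: mnorm2_has_sup|exists v]. Qed.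

Lemma mnorm2_le c : (forall v, vnorm2 v <= 1 -> vnorm2 (M *m v) <= c) ->
  mnorm2 M <= c.
Proof.
move=> H; apply: ge_sup; first by case: mnorm2_has_sup.
by move=> _ [v v1 <-]; exact: H.
Qed.

Lemma vnorm2_mulmx_le v : vnorm2 (M *m v) <= mnorm2 M * vnorm2 v.
Proof.
have [v0|v0] := eqVneq (vnorm2 v) 0.
  by rewrite (vnorm2_eq0 v0) mulmx0 !vnorm2_0 mulr0.
have vp : 0 < vnorm2 v by rewrite lt0r v0 vnorm2_ge0.
rewrite -ler_pdivrMr// mulrC.
have nE : cabs (vnorm2 v)^-1%:C%C = (vnorm2 v)^-1.
  by rewrite cabs_real gtr0_norm// invr_gt0.
rewrite -{1}nE -vnorm2Z scalemxAr; apply: mnorm2_ge.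
by rewrite vnorm2Z nE mulVf.
Qed.

Lemma cabs_bilinear_le (w : 'rV[C]_m) (v : 'cV[C]_n) :
  cabs ((w *m M *m v) 0 0) <= mnorm2 M * (vnorm2 w^T * vnorm2 v).
Proof.
rewrite -mulmxA; apply: le_trans (cabs_dot_le _ _) _.
rewrite mulrCA; apply: ler_wpM2l; first exact: vnorm2_ge0.
exact: vnorm2_mulmx_le.
Qed.

End OperatorNorm.

(** The bound [|w M v| <= mnorm2 M |w| |v|] is attained by a multiple of the
    rank-one matrix [conj(w)^T conj(v)^T]; its phase is chosen to make the
    product with [s] nonnegative.  The factor [s] will carry the power of the
    eigenvalue and the sign of a block. *)
Lemma extremal_matrix m n (w : 'rV[C]_m) (v : 'cV[C]_n) (a : R) (s : C) :
  0 <= a -> exists2 M : 'M[C]_(m, n), mnorm2 M <= a &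
    s * (w *m M *m v) 0 0 = (cabs s * (a * (vnorm2 w^T * vnorm2 v)))%:C%C.
Proof.
move=> a0.
have conjE (z : C) : z * z^*%C = (cabs z ^+ 2)%:C%C.
  by rewrite -sqr_normc rmorphXn; case: z.
pose ws := map_mx (@conjc R) w; pose vs := map_mx (@conjc R) v.
have wws : (w *m ws^T) 0 0 = (vnorm2 w^T ^+ 2)%:C%C.
  rewrite mxE vnorm2_sqr rmorph_sum; apply: eq_bigr => i _ /=.
  by rewrite !mxE conjE.
have vsv : (vs^T *m v) 0 0 = (vnorm2 v ^+ 2)%:C%C.
  rewrite mxE vnorm2_sqr rmorph_sum; apply: eq_bigr => i _ /=.
  by rewrite !mxE mulrC conjE.
(* When [w] or [v] is zero, or [s] is zero, the division by zero makes the
   matrix zero, which is the right choice in these cases too. *)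
pose k := a / (vnorm2 w^T * vnorm2 v).
pose ph := s^*%C / (cabs s)%:C%C.
have k0 : 0 <= k by rewrite divr_ge0// mulr_ge0 ?vnorm2_ge0.
have ph1 : cabs ph <= 1.
  have nJ : cabs s^*%C = cabs s by case: (s) => x y /=; rewrite sqrrN.
  rewrite Normc.normcM Normc.normcV cabs_real ger0_norm ?cabs_ge0// nJ.
  by have [->|?] := eqVneq (cabs s) 0; [rewrite mul0r|rewrite divff].
exists ((ph * k%:C%C) *: (ws^T *m vs^T)).
  apply: mnorm2_le => u u1.
  have nws : vnorm2 ws^T = vnorm2 w^T.
    congr Num.sqrt; apply: eq_bigr => i _; rewrite !mxE.
    by case: (w 0 i) => x y /=; rewrite sqrrN.
  have nvs : vnorm2 vs = vnorm2 v.
    congr Num.sqrt; apply: eq_bigr => i _; rewrite !mxE.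
    by case: (v i 0) => x y /=; rewrite sqrrN.
  rewrite -scalemxAl -mulmxA [vs^T *m u]mx11_scalar mul_mx_scalar !vnorm2Z nws.
  have := cabs_dot_le vs^T u; rewrite trmxK nvs => le1.
  rewrite Normc.normcM cabs_real ger0_norm//.
  apply: (@le_trans _ _ (1 * k * (vnorm2 v * 1 * vnorm2 w^T))).
    apply: ler_pM; rewrite ?mulr_ge0 ?cabs_ge0 ?vnorm2_ge0//.
      by rewrite invr_ge0 mulr_ge0 ?vnorm2_ge0.
      by apply: ler_wpM2r.
    apply: ler_wpM2r; first exact: vnorm2_ge0.
    by apply: le_trans le1 _; rewrite ler_wpM2l ?vnorm2_ge0.
  rewrite mul1r mulr1 [vnorm2 v * _]mulrC /k.
  by have [->|?] := eqVneq (vnorm2 w^T * vnorm2 v) 0; [rewrite mulr0|rewrite divfK].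
have E : w *m (ws^T *m vs^T) *m v = (w *m ws^T) *m (vs^T *m v).
  by rewrite !mulmxA.
rewrite -scalemxAr -scalemxAl E [w *m _]mx11_scalar [_ *m v]mx11_scalar wws vsv.
rewrite -scalar_mxM mxE mxE eqxx mulr1n -rmorphM /=.
have -> : s * (ph * k%:C%C * (vnorm2 w^T ^+ 2 * vnorm2 v ^+ 2)%:C%C)
   = (s * s^*%C) / (cabs s)%:C%C * (k * (vnorm2 w^T ^+ 2 * vnorm2 v ^+ 2))%:C%C.
  have -> : forall N : R, (k * N)%:C%C = k%:C%C * N%:C%C by move=> N; rewrite -rmorphM.
  by rewrite /ph; ring.
rewrite conjE -fmorphV -!rmorphM /=; congr (_%:C%C).
have -> : cabs s ^+ 2 / cabs s = cabs s.
  by have [->|?] := eqVneq (cabs s) 0; [rewrite invr0 mulr0|rewrite expr2 mulfK].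
congr (_ * _); rewrite /k -exprMn; move: (vnorm2 w^T * vnorm2 v) => x.
by have [->|?] := eqVneq x 0; [rewrite expr0n !mulr0|rewrite expr2 mulrA divfK].
Qed.

End Norms.

(** * The local ring of rational functions at a point *)

Section LocalRing.
Variables (K : fieldType).
Implicit Types (f g : ratfun K) (z c : K).

(** [f] belongs to the local ring at [z] and its residue is [c].  As a relation
    it states the absence of a pole and the value at once, and is visibly
    compatible with the ring operations. *)
Definition val_at z f c : Prop :=
  exists p q : {poly K},
    [/\ q.[z] != 0, f = tofrac p / tofrac q & c = p.[z] / q.[z]].

Lemma horner_neq0 (q : {poly K}) z : q.[z] != 0 -> q != 0.
Proof. by apply: contraNneq => ->; rewrite horner0. Qed.

Lemma rnum_rdenE f : f = tofrac (rnum f) / tofrac (rden f).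
Proof.
have d0 : (repr f).2 != 0 by exact: denom_ratioP.
have g0 : gcdp (repr f).1 (repr f).2 != 0 by rewrite gcdp_eq0 negb_and d0 orbT.
have eqn : (repr f).1 = rnum f * gcdp (repr f).1 (repr f).2.
  by rewrite divpK ?dvdp_gcdl.
have eqd : (repr f).2 = rden f * gcdp (repr f).1 (repr f).2.
  by rewrite divpK ?dvdp_gcdr.
have G0 : tofrac (gcdp (repr f).1 (repr f).2) != 0 by rewrite tofrac_eq0.
rewrite {1}[f]repr_fracE {1}eqn {2}eqd !rmorphM /= -mulf_div divff//.
by rewrite mulr1.
Qed.

Lemma val_atP z f c : val_at z f c <-> no_pole f z /\ reval f z = c.
Proof.
split=> [[p [q [qz -> ->]]]|[np <-]]; first exact: reval_frac.
by exists (rnum f), (rden f); split=> //; exact: rnum_rdenE.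
Qed.

Lemma val_at_uniq z f c c' : val_at z f c -> val_at z f c' -> c = c'.
Proof. by move=> /val_atP[_ <-] /val_atP[_ <-]. Qed.

Lemma val_at_poly z (p : {poly K}) : val_at z (tofrac p) p.[z].
Proof.
exists p, 1; rewrite hornerC oner_neq0; split=> //; last by rewrite divr1.
by rewrite rmorph1 divr1.
Qed.

Lemma val_at_cst z c : val_at z (tofrac c%:P) c.
Proof. by have := val_at_poly z c%:P; rewrite hornerC. Qed.

Lemma val_at0 z : val_at z 0 0.
Proof. by have := val_at_cst z 0; rewrite !rmorph0. Qed.

Lemma val_at1 z : val_at z 1 1.
Proof. by have := val_at_cst z 1; rewrite !rmorph1. Qed.

Lemma val_atD z f g c d : val_at z f c -> val_at z g d -> val_at z (f + g) (c + d).
Proof.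
move=> [p [q [qz -> ->]]] [p' [q' [q'z -> ->]]].
have q0 := horner_neq0 qz; have q'0 := horner_neq0 q'z.
exists (p * q' + p' * q), (q * q'); rewrite !hornerE mulf_neq0//; split=> //.
  by rewrite addf_div ?tofrac_eq0// -!rmorphM -rmorphD.
by rewrite addf_div.
Qed.

Lemma val_atM z f g c d : val_at z f c -> val_at z g d -> val_at z (f * g) (c * d).
Proof.
move=> [p [q [qz -> ->]]] [p' [q' [q'z -> ->]]].
exists (p * p'), (q * q'); rewrite !hornerM mulf_neq0//; split=> //.
  by rewrite mulf_div -!rmorphM.
by rewrite mulf_div.
Qed.

Lemma val_atN z f c : val_at z f c -> val_at z (- f) (- c).
Proof.
move=> [p [q [qz -> ->]]]; exists (- p), q; rewrite hornerN; split=> //.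
  by rewrite rmorphN mulNr.
by rewrite mulNr.
Qed.

Lemma val_atV z f c : val_at z f c -> c != 0 -> val_at z f^-1 c^-1.
Proof.
move=> [p [q [qz -> ->]]]; rewrite mulf_eq0 negb_or => /andP[pz _].
by exists q, p; split=> //; rewrite invf_div.
Qed.

Lemma val_at_sum z I (s : seq I) (P : pred I) (f : I -> ratfun K) (c : I -> K) :
  (forall i, P i -> val_at z (f i) (c i)) ->
  val_at z (\sum_(i <- s | P i) f i) (\sum_(i <- s | P i) c i).
Proof. 
move=> H; elim/big_rec2: _ => [|i x y Pi]; first exact: val_at0.
by apply: val_atD; exact: H.
Qed.

Lemma val_at_prod z I (s : seq I) (P : pred I) (f : I -> ratfun K) (c : I -> K) :
  (forall i, P i -> val_at z (f i) (c i)) ->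
  val_at z (\prod_(i <- s | P i) f i) (\prod_(i <- s | P i) c i).
Proof. 
move=> H; elim/big_rec2: _ => [|i x y Pi]; first exact: val_at1.
by apply: val_atM; exact: H.
Qed.

Lemma val_at_sign z (k : nat) : val_at z ((-1) ^+ k) ((-1) ^+ k).
Proof.
elim: k => [|k IH]; first by rewrite !expr0; exact: val_at1.
by rewrite !exprS; apply: val_atM => //; apply: val_atN; exact: val_at1.
Qed.

Definition uniformizer z : ratfun K := tofrac ('X - z%:P).

Lemma uniformizer_neq0 z : uniformizer z != 0.
Proof. by rewrite tofrac_eq0 polyXsubC_eq0. Qed.

Lemma val_at_div_unif z f : val_at z f 0 -> exists c, val_at z (f / uniformizer z) c.
Proof.
move=> [p [q [qz -> /esym/eqP]]]; rewrite mulf_eq0 invr_eq0 (negPf qz) orbF.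
move=> /factor_theorem[p' ->]; exists (p'.[z] / q.[z]), p', q; split=> //.
by rewrite rmorphM mulrAC mulfK ?uniformizer_neq0.
Qed.

Definition mval_at z m n (M : 'M[ratfun K]_(m, n)) (N : 'M[K]_(m, n)) : Prop :=
  forall i j, val_at z (M i j) (N i j).

Lemma mval_at_uniq z m n (M : 'M[ratfun K]_(m, n)) N N' :
  mval_at z M N -> mval_at z M N' -> N = N'.
Proof. by move=> h h'; apply/matrixP => i j; exact: val_at_uniq (h i j) (h' i j). Qed.

Lemma mval_atD z m n (M1 M2 : 'M[ratfun K]_(m, n)) N1 N2 :
  mval_at z M1 N1 -> mval_at z M2 N2 -> mval_at z (M1 + M2) (N1 + N2).
Proof. by move=> h1 h2 i j; rewrite !mxE; exact: val_atD. Qed.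

Lemma mval_atN z m n (M1 : 'M[ratfun K]_(m, n)) N1 :
  mval_at z M1 N1 -> mval_at z (- M1) (- N1).
Proof. by move=> h1 i j; rewrite !mxE; exact: val_atN. Qed.

Lemma mval_atZ z m n f c (M1 : 'M[ratfun K]_(m, n)) N1 :
  val_at z f c -> mval_at z M1 N1 -> mval_at z (f *: M1) (c *: N1).
Proof. by move=> h h1 i j; rewrite !mxE; exact: val_atM. Qed.

Lemma mval_at_tr z m n (M1 : 'M[ratfun K]_(m, n)) N1 :
  mval_at z M1 N1 -> mval_at z M1^T N1^T.
Proof. by move=> h1 i j; rewrite !mxE. Qed.

Lemma mval_atM z m n p (M1 : 'M[ratfun K]_(m, n)) (M2 : 'M[ratfun K]_(n, p)) N1 N2 :
  mval_at z M1 N1 -> mval_at z M2 N2 -> mval_at z (M1 *m M2) (N1 *m N2).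
Proof.
by move=> h1 h2 i j; rewrite !mxE; apply: val_at_sum => k _; exact: val_atM.
Qed.

Lemma mval_at0 z m n : mval_at z (0 : 'M[ratfun K]_(m, n)) 0.
Proof. by move=> i j; rewrite !mxE; exact: val_at0. Qed.

Lemma mval_at_col z m1 m2 n (M1 : 'M[ratfun K]_(m1, n)) (M2 : 'M[ratfun K]_(m2, n)) N1 N2 :
  mval_at z M1 N1 -> mval_at z M2 N2 -> mval_at z (col_mx M1 M2) (col_mx N1 N2).
Proof. by move=> h1 h2 i j; rewrite !mxE; case: (fintype.split i). Qed.

Lemma mval_at_row z m n1 n2 (M1 : 'M[ratfun K]_(m, n1)) (M2 : 'M[ratfun K]_(m, n2)) N1 N2 :
  mval_at z M1 N1 -> mval_at z M2 N2 -> mval_at z (row_mx M1 M2) (row_mx N1 N2).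
Proof. by move=> h1 h2 i j; rewrite !mxE; case: (fintype.split j). Qed.

Lemma mval_at_cst z m n (N : 'M[K]_(m, n)) : mval_at z (ratmx (map_mx polyC N)) N.
Proof. by move=> i j; rewrite !mxE; exact: val_at_cst. Qed.

Lemma ratmx_cstM m n p (M : 'M[K]_(m, n)) (N : 'M[K]_(n, p)) :
  ratmx (map_mx polyC (M *m N)) = ratmx (map_mx polyC M) *m ratmx (map_mx polyC N).
Proof. by rewrite -map_mxM; congr map_mx; exact: map_mxM. Qed.

Lemma val_at_det z n (M : 'M[ratfun K]_n) N :
  mval_at z M N -> val_at z (\det M) (\det N).
Proof.
move=> h; apply: val_at_sum => s _; apply: val_atM.
  exact: val_at_sign.
by apply: val_at_prod => i _; exact: h.
Qed.

Lemma mval_at_unit z n (M : 'M[ratfun K]_n) N :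
  mval_at z M N -> N \in unitmx -> M \in unitmx.
Proof.
move=> h; rewrite !unitmxE !unitfE; apply: contra_neq => M0.
by apply: val_at_uniq (val_at_det h) _; rewrite M0; exact: val_at0.
Qed.

Lemma mval_at_inv z n (M : 'M[ratfun K]_n) N :
  mval_at z M N -> N \in unitmx -> mval_at z (invmx M) (invmx N).
Proof.
move=> h uN; rewrite /invmx (mval_at_unit h uN) uN; apply: mval_atZ.
  by apply: val_atV; [exact: val_at_det|rewrite -unitfE].
move=> i j; rewrite !mxE; apply: val_atM.
  exact: val_at_sign.
by apply: val_at_det => k l; rewrite !mxE.
Qed.

(** The maximal ideal of the local ring is generated by the uniformizer. *)
Lemma mval_at_div_unif z m n (M : 'M[ratfun K]_(m, n)) :
  mval_at z M 0 -> exists M1 N1, M = uniformizer z *: M1 /\ mval_at z M1 N1.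
Proof.
move=> h.
have /choice[c hc] : forall ij : 'I_m * 'I_n,
    exists c, val_at z (M ij.1 ij.2 / uniformizer z) c.
  move=> [i j]; apply: val_at_div_unif; have := h i j; by rewrite mxE.
exists (\matrix_(i, j) (M i j / uniformizer z)), (\matrix_(i, j) c (i, j)); split.
  by apply/matrixP => i j; rewrite !mxE mulrC divfK ?uniformizer_neq0.
by move=> i j; rewrite !mxE; exact: (hc (i, j)).
Qed.

End LocalRing.

Section LocalLimits.
Variable R : realType.
Local Notation C := R[i].

Lemma mval_at_pmeval z m n (P : 'M[{poly C}]_(m, n)) :
  mval_at z (ratmx P) (pmeval P z).
Proof. by move=> i j; rewrite !mxE; exact: val_at_poly. Qed.

Lemma mval_atP z m n (M : 'M[ratfun C]_(m, n)) N :
  mval_at z M N <-> mx_no_pole M z /\ rmeval M z = N.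
Proof.
split=> [h|[np <-] i j].
  split; first by move=> i j; have /val_atP[] := h i j.
  by apply/matrixP => i j; rewrite mxE; have /val_atP[] := h i j.
by apply/val_atP; rewrite mxE.
Qed.

Lemma dnbhs_id (z : C) : t @[t --> z^'] --> z.
Proof. exact: cvg_within. Qed.
Arguments dnbhs_id z : clear implicits.

Lemma near_horner_neq0 (q : {poly C}) (z : C) :
  q != 0 -> \forall t \near z^', q.[t] != 0.
Proof.
move=> q0; have [rs ->] := closed_field_poly_normal q.
have l0 : lead_coef q != 0 by rewrite lead_coef_eq0.
elim: rs => [|s rs IH].
  by apply: filterS filterT => t _; rewrite big_nil hornerZ hornerC mulr1.
have ts : \forall t \near z^', t != s.
  have [->|zs] := eqVneq s z; first exact: nbhs_dnbhs_neq.
  have : \forall t \near z^', t - s != 0.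
    apply: (@near_neq0 R _ _ _ _ (z - s)); last by rewrite subr_eq0 eq_sym.
    by apply: cvgB; [exact: dnbhs_id|exact: cvg_cst].
  by apply: filterS => t; rewrite subr_eq0.
near=> t; have : (lead_coef q *: \prod_(z0 <- rs) ('X - z0%:P)).[t] != 0.
  by near: t.
rewrite !hornerZ big_cons hornerM hornerXsubC !mulf_eq0 !negb_or => /andP[-> ->].
by rewrite subr_eq0 andbT; near: t.
Unshelve. all: by end_near. Qed.

Lemma rden_neq0 (f : ratfun C) : rden f != 0.
Proof.
have d0 : (repr f).2 != 0 by exact: denom_ratioP.
apply: contraNneq d0 => rd0.
by rewrite -(divpK (dvdp_gcdr (repr f).1 (repr f).2)) [X in X * _]rd0 mul0r.
Qed.

Lemma near_mval_at m n (M : 'M[ratfun C]_(m, n)) (z : C) :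
  \forall t \near z^', mval_at t M (rmeval M t).
Proof.
have np i j : \forall t \near z^', no_pole (M i j) t.
  exact: near_horner_neq0 (rden_neq0 _).
have : \forall t \near z^', forall i j, no_pole (M i j) t.
  by apply: filter_forall => i; apply: filter_forall => j; exact: np.
by apply: filterS => t npt; apply/mval_atP.
Qed.

Lemma mval_at_cvg m n (M : 'M[ratfun C]_(m, n)) N (z : C) :
  mval_at z M N -> mcvg z^' (rmeval M) N.
Proof.
move=> h i j; under eq_fun do rewrite mxE.
have [p [q [qz MijE ->]]] := h i j.
apply: (@cvg_trans _ (p.[t] / q.[t] @[t --> z^'])).
  apply: near_eq_cvg; have := near_horner_neq0 z (horner_neq0 qz).
  by apply: filterS => t qt; rewrite MijE; have [_ ->] := reval_frac p qt.
have cp : p.[t] @[t --> z^'] --> p.[z] by exact: cvg_horner (dnbhs_id z).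
have cq : q.[t] @[t --> z^'] --> q.[z] by exact: cvg_horner (dnbhs_id z).
exact: cvgM cp (cvgV qz cq).
Qed.

(** In lowest terms the numerator does not vanish at a pole, so a function that
    has a finite limit has no pole. *)
Lemma reval_cvg (f : ratfun C) (l z : C) :
  reval f t @[t --> z^'] --> l -> val_at z f l.
Proof.
move=> cf.
have cn : (rnum f).[t] @[t --> z^'] --> (rnum f).[z].
  exact: cvg_horner (dnbhs_id z).
have cd : (rden f).[t] @[t --> z^'] --> (rden f).[z].
  exact: cvg_horner (dnbhs_id z).
have nE : (rnum f).[z] = l * (rden f).[z].
  have c1 : reval f t * (rden f).[t] @[t --> z^'] --> l * (rden f).[z].
    exact: cvgM cf cd.
  have c2 : reval f t * (rden f).[t] @[t --> z^'] --> (rnum f).[z].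
    apply: cvg_trans cn; apply: near_eq_cvg.
    have := near_horner_neq0 z (rden_neq0 f); apply: filterS => t dt.
    by rewrite /reval divfK.
  exact: (cvg_unique _ c2 c1).
have dz : (rden f).[z] != 0.
  have cop : coprimep (rnum f) (rden f).
    by apply: coprimep_div_gcd; rewrite (denom_ratioP (repr f)) orbT.
  have [d0|//] := eqVneq (rden f).[z] 0.
  have n0 : root (rnum f) z by rewrite /root nE d0 mulr0.
  by have := coprimep_root cop n0; rewrite d0 eqxx.
by apply/val_atP; split; [exact: dz|rewrite /reval nE mulfK].
Qed.

Lemma mreval_cvg m n (M : 'M[ratfun C]_(m, n)) N (z : C) :
  rmeval M t @[t --> z^'] --> N -> mval_at z M N.
Proof.
move=> /mcvgP c i j; apply: reval_cvg; have := c i j.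
by under eq_fun do rewrite mxE.
Qed.

End LocalLimits.

Arguments dnbhs_id {R} z.

(** * Root vectors of the transfer function and kernels of the system matrix *)

Section TransferIdentities.
Variables (K : fieldType) (n p : nat).
Variables (A : 'M[K]_n) (B : 'M[K]_(n, p)) (C : 'M[K]_(p, n)) (D : 'M[K]_p).
Hypothesis uA : A \in unitmx.

Lemma system_mulmx q (x : 'M[K]_(p, q)) :
  block_mx (- A) B C D *m col_mx (invmx A *m B *m x) x =
  col_mx 0 ((D + C *m invmx A *m B) *m x).
Proof.
rewrite mul_block_col mulNmx !mulmxA mulmxV// mul1mx addNr.
by rewrite mulmxDl addrC.
Qed.

Lemma mulmx_system q (y : 'M[K]_(q, p)) :
  row_mx (y *m C *m invmx A) y *m block_mx (- A) B C D =
  row_mx 0 (y *m (D + C *m invmx A *m B)).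
Proof.
rewrite mul_row_block mulmxN mulmxKV// addNr.
by rewrite mulmxDr addrC !mulmxA.
Qed.

End TransferIdentities.

(** Both terms on the left are Schur complements.  The mixed form, with the
    data of the first system on the left and those of the second on the right,
    gives the difference quotient of the transfer function without
    differentiating an inverse. *)
Lemma transfer_diff (K : fieldType) (n p : nat)
  (A A' : 'M[K]_n) (B B' : 'M[K]_(n, p)) (C C' : 'M[K]_(p, n)) (D D' : 'M[K]_p) :
  A \in unitmx -> A' \in unitmx ->
  (D + C *m invmx A *m B) - (D' + C' *m invmx A' *m B') =
  row_mx (C *m invmx A) 1%:M *m
    (block_mx (- A) B C D - block_mx (- A') B' C' D') *m
  col_mx (invmx A' *m B') 1%:M.
Proof.
move=> uA uA'.
have := mulmx_system B C D uA 1%:M; rewrite !mul1mx mulmxBr => ->.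
have := system_mulmx B' C' D' uA' 1%:M; rewrite !mulmx1 mulmxBl -!mulmxA => ->.
by rewrite !mul_row_col !mul0mx mulmx0 mul1mx mulmx1 !add0r !mulmxA.
Qed.

Section FullRank.
Variables (K : fieldType).

(** Full column rank of the residue gives a constant left inverse [L] of it, so
    that [L M] is invertible over the local ring. *)
Lemma full_rank_no_pole (z : K) k n q (M : 'M[ratfun K]_(k, n)) N
    (u : 'M[ratfun K]_(n, q)) b :
  mval_at z M N -> \rank N = n -> mval_at z (M *m u) b ->
  exists c, mval_at z u c.
Proof.
move=> MN rN Mub; have /row_fullP[L LN] : row_full N by rewrite /row_full rN.
have LM : mval_at z (ratmx (map_mx polyC L) *m M) 1%:M.
  by rewrite -LN; apply: mval_atM => //; exact: mval_at_cst.
have uLM := mval_at_unit LM (unitmx1 _ _).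
exists (invmx 1%:M *m (L *m b)).
rewrite -(mulKmx uLM u) -mulmxA; apply: mval_atM.
  by apply: mval_at_inv; rewrite ?unitmx1.
by apply: mval_atM => //; exact: mval_at_cst.
Qed.

End FullRank.

Section SimpleZero.
Variables (K : fieldType) (z : K).

(** Dividing by the uniformizer never creates a zero. *)
Lemma val_at_expz_le0 (k : int) (f : ratfun K) :
  k <= 0 -> val_at z (uniformizer z ^ k * f) 0 -> val_at z f 0.
Proof.
move=> k0 h; have -> : f = uniformizer z ^+ `|k|%N * (uniformizer z ^ k * f).
  rewrite mulrA exprnP -expfzDr ?uniformizer_neq0//.
  by rewrite abszE ler0_norm// addNr expr0z mul1r.
have uk : val_at z (uniformizer z ^+ `|k|%N) (('X - z%:P) ^+ `|k|%N).[z].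
  by rewrite -rmorphXn; exact: val_at_poly.
by have := val_atM uk h; rewrite mulr0.
Qed.

Variables (p : nat) (M G1 G2 : 'M[ratfun K]_p) (N1 N2 : 'M[K]_p).
Variables (nu : 'I_p -> int) (i0 : 'I_p).
Hypotheses (G1v : mval_at z G1 N1) (G2v : mval_at z G2 N2).
Hypotheses (u1 : N1 \in unitmx) (u2 : N2 \in unitmx).
Let d : 'rV[ratfun K]_p := \row_i uniformizer z ^ nu i.
Hypothesis GMG : G1 *m M *m G2 = diag_mx d.
Hypotheses (nu1 : nu i0 = 1) (nupos : forall j, 0 < nu j -> j = i0).

(** In the coordinates [xi = G2^-1 x] and [eta = G1^-T y] the matrix is diagonal.
    At an index whose order is not positive, the coordinate of a root vector
    must vanish; only the coordinate [i0] of order 1 survives.  In the pairing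
    [y^T M x], divided by the uniformizer, the index [i0] contributes the
    product of the two surviving coordinates, and any other index contributes a
    product of two functions that vanish, divided by the uniformizer, hence 0. *)
Lemma local_smith_root_vectors : exists (e f : 'cV[K]_p),
  [/\ forall (x : 'cV[ratfun K]_p) c, mval_at z x c -> mval_at z (M *m x) 0 ->
        exists a, c = a *: e,
      forall (y : 'cV[ratfun K]_p) c, mval_at z y c -> mval_at z (y^T *m M) 0 ->
        exists a, c = a *: f &
      forall (x y : 'cV[ratfun K]_p) c d, mval_at z x c -> mval_at z y d ->
        mval_at z (M *m x) 0 -> mval_at z (y^T *m M) 0 -> c != 0 -> d != 0 ->
        exists2 s, s != 0 & val_at z ((y^T *m M *m x) 0 0 / uniformizer z) s].
Proof.
have uG1 := mval_at_unit G1v u1; have uG2 := mval_at_unit G2v u2.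
have val0 i f : i != i0 -> val_at z (d 0 i * f) 0 -> val_at z f 0.
  move=> ne; rewrite mxE; apply: val_at_expz_le0.
  by rewrite leNgt; apply/negP => /nupos /eqP; rewrite (negPf ne).
pose xi (x : 'cV[ratfun K]_p) := invmx G2 *m x.
pose eta (y : 'cV[ratfun K]_p) := (invmx G1)^T *m y.
have xiE x c : mval_at z x c -> mval_at z (M *m x) 0 ->
    mval_at z (xi x) (invmx (N2) *m c) /\
    forall i, i != i0 -> val_at z (xi x i 0) 0.
  move=> xc Mx; split.
    by apply: mval_atM; [exact: mval_at_inv|exact: xc].
  move=> i ne; apply: (val0 i) => //.
  have : mval_at z (diag_mx d *m xi x) (N1 *m 0).
    by rewrite -GMG /xi -!mulmxA (mulKVmx uG2); exact: mval_atM.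
  by rewrite mulmx0 => /(_ i 0); rewrite mul_diag_mx !mxE.
have etaE y c : mval_at z y c -> mval_at z (y^T *m M) 0 ->
    mval_at z (eta y) ((invmx (N1))^T *m c) /\
    forall i, val_at z (d 0 i * eta y i 0) 0.
  move=> yc My; split.
    apply: mval_atM; last exact: yc.
    by apply: mval_at_tr; exact: mval_at_inv.
  move=> i.
  have : mval_at z ((eta y)^T *m diag_mx d) (0 *m N2).
    rewrite -GMG /eta trmx_mul trmxK !mulmxA (mulmxKV uG1); exact: mval_atM.
  by rewrite mul0mx => /(_ 0 i); rewrite mul_mx_diag !mxE mulrC.
have coords (c : 'cV[K]_p) : (forall i, i != i0 -> c i 0 = 0) ->
    c = c i0 0 *: delta_mx i0 0.
  move=> c0; apply/matrixP => i j; rewrite !ord1 !mxE.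
  by have [->|ne] := eqVneq i i0; rewrite /= ?mulr1// mulr0 c0.
have xiv x c : mval_at z x c -> mval_at z (M *m x) 0 ->
    exists2 a, val_at z (xi x i0 0) a & c = a *: (N2 *m delta_mx i0 0).
  move=> xc Mx; have [xv x0] := xiE _ _ xc Mx; set c' := _ *m c in xv.
  exists (c' i0 0); first exact: xv.
  rewrite scalemxAr -coords//; first by rewrite mulKVmx.
  by move=> i ne; apply: val_at_uniq (xv i 0) (x0 i ne).
have etav y c : mval_at z y c -> mval_at z (y^T *m M) 0 ->
    exists2 a, val_at z (eta y i0 0) a & c = a *: ((N1)^T *m delta_mx i0 0).
  move=> yc yM; have [yv y0] := etaE _ _ yc yM; set c' := _ *m c in yv.
  exists (c' i0 0); first exact: yv.
  rewrite scalemxAr -coords//; first by rewrite /c' trmx_inv mulKVmx// unitmx_tr.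
  by move=> i ne; apply: val_at_uniq (yv i 0) (val0 _ _ ne (y0 i)).
exists (N2 *m delta_mx i0 0), ((N1)^T *m delta_mx i0 0); split.
- by move=> x c xc Mx; have [a _ ->] := xiv _ _ xc Mx; exists a.
- by move=> y c yc yM; have [a _ ->] := etav _ _ yc yM; exists a.
move=> x y c c' xc yc' Mx yM c0 c'0.
have [a xa cE] := xiv _ _ xc Mx; have [a' ya c'E] := etav _ _ yc' yM.
have a0 : a != 0 by apply: contra_neq c0 => a0; rewrite cE a0 scale0r.
have a'0 : a' != 0 by apply: contra_neq c'0 => a0'; rewrite c'E a0' scale0r.
exists (a' * a); first exact: mulf_neq0.
have -> : y^T *m M *m x = (eta y)^T *m diag_mx d *m xi x.
  rewrite -GMG /eta /xi trmx_mul trmxK !mulmxA (mulmxKV uG1).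
  by rewrite -!mulmxA mulKVmx.
have etaD i : ((eta y)^T *m diag_mx d) 0 i = d 0 i * eta y i 0.
  by rewrite mul_mx_diag mxE [(eta y)^T _ _]mxE mulrC.
have dE : d 0 i0 = uniformizer z by rewrite mxE nu1 expr1z.
rewrite mxE (bigD1 i0) //= mulrDl -[a' * a]addr0; apply: val_atD.
  rewrite etaD dE -[uniformizer z * _ * _]mulrA [uniformizer z * _]mulrC mulfK ?uniformizer_neq0 //.
  exact: val_atM.
rewrite mulr_suml; have -> : 0 = \sum_(i < p | i != i0) (0 : K) by rewrite big1.
have [xv x0] := xiE _ _ xc Mx; have [_ y0] := etaE _ _ yc' yM.
apply: val_at_sum => i ne; have [b bv] := val_at_div_unif (x0 i ne).
by have := val_atM (y0 i) bv; rewrite mul0r mulrA -etaD.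
Qed.

End SimpleZero.

(** * The kernels of the system matrix at the simple zero *)

Section LocalDerivative.
Variable R : realType.
Local Notation C := R[i].

(** Both sides are limits of difference quotients: the residue exists by
    divisibility, and the value of the function at a nearby [t] is
    [ddiff q t z]. *)
Lemma val_at_ddiff (q : {poly C}) (z : C) :
  val_at z ((tofrac q - tofrac q.[z]%:P) / uniformizer z) (ddiff q z z).
Proof.
have h0 : val_at z (tofrac q - tofrac q.[z]%:P) 0.
  rewrite -(subrr q.[z]); apply: val_atD; first exact: val_at_poly.
  by apply: val_atN; exact: val_at_cst.
have [c hc] := val_at_div_unif h0.
suff -> : ddiff q z z = c by [].
set f := _ / _ in hc.
have cv1 : reval f t @[t --> z^'] --> c.
  have fv : mval_at z (\matrix_(i < 1, j < 1) f) (\matrix_(i < 1, j < 1) c).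
    by move=> i j; rewrite !mxE.
  have := mval_at_cvg fv (i:=0) (j:=0).
  by under eq_fun do rewrite !mxE; rewrite mxE.
have cv2 : ddiff q t z @[t --> z^'] --> ddiff q z z.
  by apply: cvg_ddiff; [exact: dnbhs_id|exact: cvg_cst].
suff cv3 : ddiff q t z @[t --> z^'] --> c by exact: (cvg_unique _ cv2 cv3).
apply: cvg_trans cv1; apply: near_eq_cvg.
have tz : \forall t \near z^', t != z by exact: nbhs_dnbhs_neq.
apply: filterS tz => t tz.
have tz' : ('X - z%:P).[t] != 0 by rewrite hornerXsubC subr_eq0.
rewrite /f -rmorphB; have [_ ->] := reval_frac (q - q.[z]%:P) tz'.
by rewrite hornerD hornerN hornerC hornerXsubC ddiffE mulrC mulKf// subr_eq0.
Qed.

(** The first-order expansion of a polynomial matrix in the local ring. *)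
Lemma ratmx_taylor m n (P : 'M[{poly C}]_(m, n)) (z : C) :
  exists2 P1, ratmx P = ratmx (map_mx polyC (pmeval P z)) + uniformizer z *: P1 &
    mval_at z P1 (mddiff P z z).
Proof.
exists (map_mx (fun q : {poly C} => (tofrac q - tofrac q.[z]%:P) / uniformizer z) P).
  apply/matrixP => i j; rewrite !mxE mulrC divfK ?uniformizer_neq0//.
  by rewrite addrC subrK.
by move=> i j; rewrite !mxE; exact: val_at_ddiff.
Qed.

End LocalDerivative.

Section SystemKernel.
Variables (R : realType) (n p : nat).
Local Notation Cx := R[i].
Variables (A : 'M[{poly Cx}]_n) (B : 'M[{poly Cx}]_(n, p))
  (C : 'M[{poly Cx}]_(p, n)) (D : 'M[{poly Cx}]_p) (z : Cx).
Local Notation P := (system_mx A B C D).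
Local Notation T := (transfer_fun A B C D).
Hypothesis regA : \det A != 0.

Lemma ratmx_unit : ratmx A \in unitmx.
Proof. by rewrite unitmxE unitfE det_map_mx tofrac_eq0. Qed.

Lemma ratmx_system : ratmx P = block_mx (- ratmx A) (ratmx B) (ratmx C) (ratmx D).
Proof. by rewrite /system_mx map_block_mx map_mxN. Qed.

Lemma pmeval_system (s : Cx) :
  pmeval P s = block_mx (- pmeval A s) (pmeval B s) (pmeval C s) (pmeval D s).
Proof.
rewrite /pmeval /system_mx map_block_mx; congr block_mx.
by apply/matrixP => i j; rewrite !mxE hornerN.
Qed.

Hypothesis minP : minimal_at A B C z.

(** The state [u = A^-1 B x] satisfies [A u = B x] and [C u = T x - D x], both
    without pole, and minimality says that the residue of the stacked matrix
    [-A; C] has full column rank. *)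
Lemma state_no_pole (x : 'cV[ratfun Cx]_p) (x0 : 'cV[Cx]_p) b :
  mval_at z x x0 -> mval_at z (T *m x) b ->
  exists u0, mval_at z (invmx (ratmx A) *m ratmx B *m x) u0.
Proof.
move=> xv Tv; have [rk _] := minP; have uA := ratmx_unit.
have Mv : mval_at z (col_mx (- ratmx A) (ratmx C)) (col_mx (- pmeval A z) (pmeval C z)).
  by apply: mval_at_col; [apply: mval_atN|]; exact: mval_at_pmeval.
pose rhs := col_mx (- (pmeval B z *m x0)) (b - pmeval D z *m x0).
apply: (full_rank_no_pole Mv rk (b := rhs)).
have -> : col_mx (- ratmx A) (ratmx C) *m (invmx (ratmx A) *m ratmx B *m x) =
    col_mx (- (ratmx B *m x)) (T *m x - ratmx D *m x).
  rewrite mul_col_mx mulNmx !mulmxA (mulmxV uA) mul1mx /transfer_fun.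
  by rewrite mulmxDl addrAC subrr add0r.
apply: mval_at_col.
  apply: mval_atN; apply: mval_atM; [exact: mval_at_pmeval|exact: xv].
apply: mval_atD; first exact: Tv.
apply: mval_atN; apply: mval_atM; [exact: mval_at_pmeval|exact: xv].
Qed.

(** Same argument as [state_no_pole] for the rows, with the full row rank of
    [A, B]. *)
Lemma costate_no_pole (y : 'cV[ratfun Cx]_p) (y0 : 'cV[Cx]_p) b :
  mval_at z y y0 -> mval_at z (y^T *m T) b ->
  exists w0, mval_at z (y^T *m ratmx C *m invmx (ratmx A)) w0.
Proof.
move=> yv Tv; have [_ rk] := minP; have uA := ratmx_unit.
have ytv := mval_at_tr yv.
have Mv : mval_at z (row_mx (ratmx A) (ratmx B))^T (row_mx (pmeval A z) (pmeval B z))^T.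
  by apply: mval_at_tr; apply: mval_at_row; exact: mval_at_pmeval.
have rk' : \rank (row_mx (pmeval A z) (pmeval B z))^T = n by rewrite mxrank_tr.
set w := _ *m invmx _.
pose rhs := row_mx (y0^T *m pmeval C z) (b - y0^T *m pmeval D z).
have [|c cv] := full_rank_no_pole Mv rk' (b := rhs^T) (u := w^T).
  rewrite -trmx_mul; apply: mval_at_tr.
  have -> : w *m row_mx (ratmx A) (ratmx B) =
      row_mx (y^T *m ratmx C) (y^T *m T - y^T *m ratmx D).
    rewrite mul_mx_row (mulmxKV uA) /transfer_fun mulmxDr addrAC subrr add0r.
    by rewrite !mulmxA.
  apply: mval_at_row; first by apply: mval_atM; [exact: ytv|exact: mval_at_pmeval].
  apply: mval_atD; first exact: Tv.
  by apply: mval_atN; apply: mval_atM; [exact: ytv|exact: mval_at_pmeval].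
by exists c^T; rewrite -[w]trmxK; exact: mval_at_tr.
Qed.

(** A kernel vector [k] of [P(z)] is corrected into a rational vector [l] with
    the same residue that satisfies the first block equation identically;
    its second component is then mapped by the transfer function to the
    residual of the second block equation, which vanishes at [z].  The
    correction uses a constant right inverse [L] of the residue of [A, B]. *)
Lemma kernel_lift (k : 'cV[Cx]_(n + p)) : pmeval P z *m k = 0 ->
  exists2 x : 'cV[ratfun Cx]_p, mval_at z x (dsubmx k) & mval_at z (T *m x) 0.
Proof.
move=> Pk; have [_ rk] := minP; have uA := ratmx_unit.
move: Pk; rewrite pmeval_system -[k]vsubmxK mul_block_col -col_mx0.
move=> /eq_col_mx[k1 k2]; rewrite col_mxKd.
set N := row_mx _ _ in rk; set M := row_mx (ratmx A) (ratmx B).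
have Mv : mval_at z M N by apply: mval_at_row; exact: mval_at_pmeval.
have /row_freeP[L NL] : row_free N by rewrite /row_free rk.
pose L' := ratmx (map_mx polyC L).
have MLv : mval_at z (M *m L') 1%:M.
  by rewrite -NL; apply: mval_atM; [exact: Mv|exact: mval_at_cst].
have uML := mval_at_unit MLv (unitmx1 _ _).
(* The first block of the system matrix is [-A]; changing the sign of the
   state turns its first block row into [A, B]. *)
pose k' := col_mx (- usubmx k) (dsubmx k); pose K := ratmx (map_mx polyC k').
have Kv : mval_at z K k' by exact: mval_at_cst.
have Nk' : N *m k' = 0.
  by rewrite /N /k' mul_row_col mulmxN -mulNmx k1.
pose l := K - L' *m (invmx (M *m L') *m (M *m K)).
have Ml : M *m l = 0.
  by rewrite /l mulmxBr mulmxA (mulKVmx uML) subrr.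
have lv : mval_at z l k'.
  rewrite -[k']subr0 -(mulmx0 _ L) -(mulmx0 _ (invmx 1%:M)) -Nk'.
  apply: mval_atD; first exact: Kv.
  apply: mval_atN; apply: mval_atM; first exact: mval_at_cst.
  apply: mval_atM; first by apply: mval_at_inv; [exact: MLv|exact: unitmx1].
  by apply: mval_atM; [exact: Mv|exact: Kv].
have luv : mval_at z (usubmx l) (- usubmx k).
  by move=> i j; have := lv (lshift p i) j; rewrite /k' col_mxEu [usubmx l _ _]mxE.
have ldv : mval_at z (dsubmx l) (dsubmx k).
  by move=> i j; have := lv (rshift n i) j; rewrite /k' col_mxEd [dsubmx l _ _]mxE.
exists (dsubmx l); first exact: ldv.
have Bl : ratmx B *m dsubmx l = - (ratmx A *m usubmx l).
  apply/eqP; rewrite -subr_eq0 opprK addrC.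
  by rewrite -mul_row_col vsubmxK; apply/eqP.
have -> : T *m dsubmx l = ratmx D *m dsubmx l - ratmx C *m usubmx l.
  rewrite /transfer_fun mulmxDl -!mulmxA Bl mulmxN (mulKmx uA).
  by rewrite mulmxN.
have -> : 0 = pmeval D z *m dsubmx k - pmeval C z *m (- usubmx k).
  by rewrite mulmxN opprK addrC k2.
apply: mval_atD; first by apply: mval_atM; [exact: mval_at_pmeval|exact: ldv].
by apply: mval_atN; apply: mval_atM; [exact: mval_at_pmeval|exact: luv].
Qed.

Hypothesis sz : simple_zero T z.

Variables (x y : 'cV[ratfun Cx]_p) (x0 y0 : 'cV[Cx]_p).
Hypotheses (xv : mval_at z x x0) (yv : mval_at z y y0).
Hypotheses (xn0 : x0 != 0) (yn0 : y0 != 0).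
Hypotheses (Tx : mval_at z (T *m x) 0) (yT : mval_at z (y^T *m T) 0).

(** The residues of the extended root vectors [(A^-1 B x, x)] and
    [(y^T C A^-1, y^T)] are kernel vectors of [P(z)].  The right kernel is a
    line because the lifts of its elements are root vectors of the transfer
    function, which are proportional at a simple zero, and because [-A; C] is
    injective.  For the pairing, [w P v = y^T T x] holds identically; expanding
    [w], [P] and [v] to first order, all terms vanish except the pairing of the
    derivative of [P], which is thus the nonzero number given by the local
    Smith form. *)
Lemma system_kernels : exists (u0 : 'cV[Cx]_n) (w0 : 'rV[Cx]_n),
  [/\ mval_at z (invmx (ratmx A) *m ratmx B *m x) u0,
      mval_at z (y^T *m ratmx C *m invmx (ratmx A)) w0,
      simple_ker (pmeval P z) (col_mx u0 x0),
      row_mx w0 y0^T *m pmeval P z = 0 &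
      (row_mx w0 y0^T *m mddiff P z z *m col_mx u0 x0) 0 0 != 0].
Proof.
have [u0 uv] := state_no_pole xv Tx; have [w0 wv] := costate_no_pole yv yT.
have uA := ratmx_unit; have [rk _] := minP.
set v0 := col_mx u0 x0; set w1 := row_mx w0 y0^T.
pose v := col_mx (invmx (ratmx A) *m ratmx B *m x) x.
pose w := row_mx (y^T *m ratmx C *m invmx (ratmx A)) y^T.
have vv : mval_at z v v0 by exact: mval_at_col.
have wv1 : mval_at z w w1 by apply: mval_at_row; [exact: wv|exact: mval_at_tr].
have Pvv : mval_at z (ratmx P) (pmeval P z) by exact: mval_at_pmeval.
have PvE : ratmx P *m v = col_mx 0 (T *m x) by rewrite ratmx_system system_mulmx.
have wPE : w *m ratmx P = row_mx 0 (y^T *m T) by rewrite ratmx_system mulmx_system.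
have Pv0 : mval_at z (ratmx P *m v) 0.
  by rewrite PvE -col_mx0; apply: mval_at_col; [exact: mval_at0|exact: Tx].
have wP0 : mval_at z (w *m ratmx P) 0.
  by rewrite wPE -row_mx0; apply: mval_at_row; [exact: mval_at0|exact: yT].
have Pzv : pmeval P z *m v0 = 0 by apply: mval_at_uniq (mval_atM Pvv vv) Pv0.
have wPz : w1 *m pmeval P z = 0 by apply: mval_at_uniq (mval_atM wv1 Pvv) wP0.
have v0n0 : v0 != 0.
  by apply: contra_neq xn0; rewrite /v0 -col_mx0 => /eq_col_mx[].
have [nu [[_ [G1 [G2 [[np1 d1] [np2 d2] GMG]]]] [i0 [nu1 nupos]]]] := sz.
have G1v : mval_at z G1 (rmeval G1 z) by apply/mval_atP.
have G2v : mval_at z G2 (rmeval G2 z) by apply/mval_atP.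
have u1 : rmeval G1 z \in unitmx by rewrite unitmxE unitfE; exact: d1.
have u2 : rmeval G2 z \in unitmx by rewrite unitmxE unitfE; exact: d2.
have [e [_ [He _ Hs]]] := local_smith_root_vectors G1v G2v u1 u2 GMG nu1 nupos.
exists u0, w0; split; [exact: uv|exact: wv| |exact: wPz|].
  split; [exact: v0n0|exact: Pzv|] => k Pk.
  have [x' x'v Tx'] := kernel_lift Pk.
  have [a ka] := He _ _ x'v Tx'; have [a0 xa] := He _ _ xv Tx.
  have a00 : a0 != 0 by apply: contra_neq xn0 => a00; rewrite xa a00 scale0r.
  exists (a / a0).
  have kx : dsubmx k = (a / a0) *: x0 by rewrite ka xa scalerA divfK.
  pose h := usubmx k - (a / a0) *: u0.
  have : pmeval P z *m (k - (a / a0) *: v0) = 0.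
    by rewrite mulmxBr Pk -scalemxAr Pzv scaler0 subr0.
  have -> : k - (a / a0) *: v0 = col_mx h 0.
    rewrite -[in LHS](vsubmxK k) scale_col_mx opp_col_mx add_col_mx kx subrr.
    by [].
  rewrite pmeval_system mul_block_col !mulmx0 !addr0 -mul_col_mx.
  have /row_fullP[L LM] : row_full (col_mx (- pmeval A z) (pmeval C z)).
    by rewrite /row_full rk.
  move=> Mh; have h0 : h = 0 by rewrite -[h]mul1mx -LM -mulmxA Mh mulmx0.
  rewrite -(vsubmxK k) kx scale_col_mx; congr col_mx.
  by apply/eqP; rewrite -subr_eq0; apply/eqP.
have [s s0 sv] := Hs _ _ _ _ xv yv Tx yT xn0 yn0.
have [P1 PE P1v] := ratmx_taylor P z.
have taylor k m (M : 'M[ratfun Cx]_(k, m)) N : mval_at z M N ->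
    exists M1 N1, M = ratmx (map_mx polyC N) + uniformizer z *: M1 /\ mval_at z M1 N1.
  move=> MN; have : mval_at z (M - ratmx (map_mx polyC N)) 0.
    rewrite -(subrr N); apply: mval_atD; first exact: MN.
    by apply: mval_atN; exact: mval_at_cst.
  move=> /mval_at_div_unif[M1 [N1 [ME M1v]]]; exists M1, N1; split=> //.
  by rewrite -ME addrC subrK.
have [v' [v'0 [vE v'v]]] := taylor _ _ _ _ vv.
have [w' [w'0 [wE w'v]]] := taylor _ _ _ _ wv1.
set cv := ratmx _ in vE; set cw := ratmx _ in wE; set cP := ratmx (map_mx _ _) in PE.
have cvv : mval_at z cv v0 by exact: mval_at_cst.
have cwv : mval_at z cw w1 by exact: mval_at_cst.
(* Only the term of [P1] survives: [P cv] and [w P] have residue 0. *)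
have cPv : cP *m cv = 0 by rewrite /cP /cv -ratmx_cstM Pzv !map_mx0.
have pairE : y^T *m T *m x = w *m ratmx P *m v.
  by rewrite wPE mul_row_col mul0mx add0r.
have E : y^T *m T *m x = uniformizer z *: (cw *m P1 *m cv + w' *m (ratmx P *m cv)
    + w *m ratmx P *m v').
  rewrite pairE [in X in _ *m X]vE mulmxDr -scalemxAr scalerDr; congr (_ + _).
  rewrite -mulmxA {1}wE mulmxDl -scalemxAl scalerDr; congr (_ + _).
  by rewrite PE mulmxDl cPv add0r -scalemxAl -scalemxAr mulmxA.
have val : mval_at z (cw *m P1 *m cv + w' *m (ratmx P *m cv) + w *m ratmx P *m v')
    (w1 *m mddiff P z z *m v0 + w'0 *m (pmeval P z *m v0) + 0 *m v'0).
  apply: mval_atD; last by apply: mval_atM; [exact: wP0|exact: v'v].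
  apply: mval_atD.
    by apply: mval_atM; [apply: mval_atM; [exact: cwv|exact: P1v]|exact: cvv].
  apply: mval_atM; first exact: w'v.
  by apply: mval_atM; [exact: Pvv|exact: cvv].
rewrite Pzv mulmx0 mul0mx !addr0 in val.
have := val 0 0; have -> : (cw *m P1 *m cv + w' *m (ratmx P *m cv) +
    w *m ratmx P *m v') 0 0 = (y^T *m T *m x) 0 0 / uniformizer z.
  by rewrite E [in RHS]mxE mulrC mulKf ?uniformizer_neq0.
by move=> /(val_at_uniq sv) <-.
Qed.

End SystemKernel.

(** * The derivative of the transfer function *)

Section TransferDerivative.
Variables (R : realType) (n p : nat).
Local Notation Cx := R[i].
Variables (A : 'M[{poly Cx}]_n) (B : 'M[{poly Cx}]_(n, p))
  (C : 'M[{poly Cx}]_(p, n)) (D : 'M[{poly Cx}]_p).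
Local Notation P := (system_mx A B C D).
Local Notation T := (transfer_fun A B C D).

Let W (s : Cx) := row_mx (pmeval C s *m invmx (pmeval A s)) 1%:M.
Let V (s : Cx) := col_mx (invmx (pmeval A s) *m pmeval B s) 1%:M.

Lemma rmeval_transfer (s : Cx) : pmeval A s \in unitmx ->
  rmeval T s = pmeval D s + pmeval C s *m invmx (pmeval A s) *m pmeval B s.
Proof.
move=> uA; suff /mval_atP[] : mval_at s T
    (pmeval D s + pmeval C s *m invmx (pmeval A s) *m pmeval B s) by [].
apply: mval_atD; first exact: mval_at_pmeval.
apply: mval_atM; last exact: mval_at_pmeval.
apply: mval_atM; first exact: mval_at_pmeval.
by apply: mval_at_inv; [exact: mval_at_pmeval|exact: uA].
Qed.

(** Pass to the limit in the difference quotient given by [transfer_diff]. *)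
Lemma rmderiv_transfer (t : Cx) : pmeval A t \in unitmx ->
  rmderiv T t = W t *m mddiff P t t *m V t.
Proof.
move=> uA.
have shift : h + t @[h --> (0 : Cx)^'] --> t.
  rewrite -[X in _ --> X]add0r; apply: cvgD; last exact: cvg_cst.
  exact: dnbhs_id.
have cA : mcvg (0 : Cx)^' (fun h => pmeval A (h + t)) (pmeval A t).
  exact: mcvg_pmeval.
have nA := near_unitmx cA uA.
have cq : mcvg (0 : Cx)^' (fun h => h^-1 *: (rmeval T (h + t) - rmeval T t))
    (W t *m mddiff P t t *m V t).
  apply: (@mcvg_near R _ _ _ _ _ (fun h => W (h + t) *m mddiff P (h + t) t *m V t)).
    have h0 : \forall h \near (0 : Cx)^', h != 0 by exact: nbhs_dnbhs_neq.
    near=> h.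
    have uAh : pmeval A (h + t) \in unitmx by near: h; exact: nA.
    have hn0 : h != 0 by near: h; exact: h0.
    rewrite (rmeval_transfer uAh) (rmeval_transfer uA) transfer_diff//.
    rewrite -!pmeval_system mddiffE addrK -/(W _) -/(V _).
    by rewrite -scalemxAr -scalemxAl scalerA mulVf// scale1r.
  apply: mcvgM; last exact: mcvg_cst.
  apply: mcvgM; last by apply: mcvg_mddiff; [exact: shift|exact: cvg_cst].
  apply: mcvg_row; last exact: mcvg_cst.
  by apply: mcvgM; [exact: mcvg_pmeval|exact: mcvg_inv].
apply/matrixP => i j; rewrite mxE /derive1; apply: cvg_lim; first exact: norm_hausdorff.
have E h : h^-1 *: (reval (T i j) (h + t) - reval (T i j) t) =
    (h^-1 *: (rmeval T (h + t) - rmeval T t)) i j by rewrite !mxE.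
by under eq_fun do rewrite E; exact: cq.
Unshelve. all: by end_near. Qed.

Variables (z : Cx) (x y : 'cV[ratfun Cx]_p) (x0 y0 : 'cV[Cx]_p).
Variables (u0 : 'cV[Cx]_n) (w0 : 'rV[Cx]_n).
Hypothesis regA : \det A != 0.
Hypotheses (xv : mval_at z x x0) (yv : mval_at z y y0).
Hypothesis uv : mval_at z (invmx (ratmx A) *m ratmx B *m x) u0.
Hypothesis wv : mval_at z (y^T *m ratmx C *m invmx (ratmx A)) w0.

(** At a regular point [y^T T' x] equals [w P' v] for the extended root vectors
    [w] and [v], and these have no pole at [z]. *)
Lemma transfer_derivative_limit :
  cabs (((rmeval y t)^T *m rmderiv T t *m rmeval x t) 0 0) @[t --> z^'] -->
  cabs ((row_mx w0 y0^T *m mddiff P z z *m col_mx u0 x0) 0 0).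
Proof.
suff cv : mcvg z^' (fun t => (rmeval y t)^T *m rmderiv T t *m rmeval x t)
    (row_mx w0 y0^T *m mddiff P z z *m col_mx u0 x0).
  by apply: cvg_cabs; exact: cv.
apply: (@mcvg_near R _ _ _ _ _ (fun t =>
  row_mx (rmeval (y^T *m ratmx C *m invmx (ratmx A)) t) (rmeval y t)^T *m
  mddiff P t t *m
  col_mx (rmeval (invmx (ratmx A) *m ratmx B *m x) t) (rmeval x t))); last first.
  apply: mcvgM.
    apply: mcvgM; last by apply: mcvg_mddiff; exact: dnbhs_id.
    by apply: mcvg_row; [|apply: mcvgT]; exact: mval_at_cvg.
  by apply: mcvg_col; exact: mval_at_cvg.
have nA : \forall t \near z^', pmeval A t \in unitmx.
  have := near_horner_neq0 z regA; apply: filterS => t At.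
  rewrite unitmxE unitfE; move: At; congr (_ != 0).
  by rewrite -horner_evalE -det_map_mx; congr (\det _).
have nx := near_mval_at x z; have ny := near_mval_at y z.
near=> t.
have uAt : pmeval A t \in unitmx by near: t; exact: nA.
have xt : mval_at t x (rmeval x t) by near: t; exact: nx.
have yt : mval_at t y (rmeval y t) by near: t; exact: ny.
have At : mval_at t (invmx (ratmx A)) (invmx (pmeval A t)).
  by apply: mval_at_inv; [exact: mval_at_pmeval|exact: uAt].
have /mval_atP[_ ->] : mval_at t (invmx (ratmx A) *m ratmx B *m x)
    (invmx (pmeval A t) *m pmeval B t *m rmeval x t).
  apply: mval_atM; last exact: xt.
  by apply: mval_atM; [exact: At|exact: mval_at_pmeval].
have /mval_atP[_ ->] : mval_at t (y^T *m ratmx C *m invmx (ratmx A))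
    ((rmeval y t)^T *m pmeval C t *m invmx (pmeval A t)).
  apply: mval_atM; last exact: At.
  by apply: mval_atM; [exact: mval_at_tr|exact: mval_at_pmeval].
rewrite (rmderiv_transfer uAt) /W /V !mulmxA mul_mx_row mulmx1 mulmxA.
by rewrite -[RHS]mulmxA mul_col_mx mul1mx.
Unshelve. all: by end_near. Qed.

End TransferDerivative.

(** * Perturbation of a simple eigenvalue *)

Section SmallParameter.
Variables (R : realType) (T : Type) (adm : set T) (eps : T -> R).

(** The admissible [t] with [eps t] tending to 0.  A statement that holds near
    this filter is uniform in everything that [t] carries besides the
    parameter, such as the direction of the perturbation and the eigenvalue. *)
Definition small_filter : set_system T :=
  filter_from [set e : R | 0 < e] (fun e => [set t | adm t /\ eps t < e]).

Global Instance small_filter_filter : Filter small_filter.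
Proof.
apply: filter_from_filter; first by exists 1 => /=; exact: ltr01.
move=> e1 e2 /= e10 e20; exists (Num.min e1 e2); first by rewrite /= lt_min e10.
by move=> t [at_]; rewrite lt_min => /andP[? ?].
Qed.

Lemma small_filter_adm : \forall t \near small_filter, adm t.
Proof. by exists 1 => /=; [exact: ltr01|move=> t []]. Qed.

Lemma small_filter_cvg0 : (forall t, adm t -> 0 < eps t) ->
  (eps t)%:C%C @[t --> small_filter] --> (0 : R[i]).
Proof.
move=> pos; apply: cabs_cvg0; apply/cvgr0Pnorm_lt => e e0.
exists e; first exact: e0.
by move=> t [at_ et]; rewrite cabs_real normr_id gtr0_norm// pos.
Qed.

End SmallParameter.

Section EigenvaluePerturbation.
Variables (R : realType) (m : nat).
Local Notation C := R[i].
Variables (P : 'M[{poly C}]_m) (z0 : C) (r : R) (v : 'cV[C]_m) (w : 'rV[C]_m).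
Hypotheses (regP : \det P != 0) (iso : isolating_radius P z0 r).
Hypotheses (kerv : simple_ker (pmeval P z0) v) (w0 : w != 0).
Hypothesis wP : w *m pmeval P z0 = 0.

Section AlongFilter.
Variables (T : Type) (F : set_system T).
Context {FF : Filter F}.

Lemma perturbed_kernel (mu : T -> C) (X : T -> 'M[C]_m) :
  mcvg F X 0 -> (\forall t \near F, cabs (mu t - z0) <= r) ->
  (\forall t \near F, \det (pmeval P (mu t) + X t) = 0) ->
  [/\ mu t @[t --> F] --> z0,
      mcvg F (fun t => pmeval P (mu t) + X t) (pmeval P z0) &
      exists2 u : T -> 'cV[C]_m, mcvg F u v &
        \forall t \near F, (pmeval P (mu t) + X t) *m u t = 0].
Proof.
move=> cX mur dX.
have cmu : mu t @[t --> F] --> z0 by exact: eigenvalue_localization cX mur dX.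
have cQ : mcvg F (fun t => pmeval P (mu t) + X t) (pmeval P z0).
  rewrite -[X in mcvg _ _ X]addr0.
  by apply: mcvgD; [exact: mcvg_pmeval|exact: cX].
split; [exact: cmu|exact: cQ|].
exact: ker_cvg kerv w0 wP cQ dX.
Qed.

(** An exact identity rather than a first-order expansion: multiply
    [(P(mu) + X) u = 0] by the left kernel vector [w] of [P(z0)]. *)
Lemma perturbation_identity (mu : C) (X : 'M[C]_m) (u : 'cV[C]_m) :
  (pmeval P mu + X) *m u = 0 ->
  (mu - z0) * (w *m mddiff P mu z0 *m u) 0 0 = - (w *m X *m u) 0 0.
Proof.
move=> Qu; have Pmu : pmeval P mu = pmeval P z0 + (mu - z0) *: mddiff P mu z0.
  by rewrite -mddiffE addrC subrK.
have : w *m ((pmeval P mu + X) *m u) = 0 by rewrite Qu mulmx0.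
rewrite Pmu !mulmxA 2!mulmxDr wP add0r -scalemxAr mulmxDl -scalemxAl.
by move=> /matrixP/(_ 0 0)/eqP; rewrite mxE mxE [X in _ == X]mxE addr_eq0 => /eqP.
Qed.

Hypothesis wPv : (w *m mddiff P z0 z0 *m v) 0 0 != 0.

(** Take a left kernel vector [y] at [mu1] and a right one [u] at [mu2].  Then
    [y (Q(mu2) - Q(mu1)) u = 0], that is, [mu2 - mu1] times a number that
    converges to the nonzero pairing [w P'(z0) v]. *)
Lemma perturbed_eigenvalue_uniq (eps : T -> C) (E : 'M[{poly C}]_m)
    (mu1 mu2 : T -> C) :
  eps t @[t --> F] --> (0 : C) ->
  (\forall t \near F, cabs (mu1 t - z0) <= r) ->
  (\forall t \near F, cabs (mu2 t - z0) <= r) ->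
  mcvg F (fun t => eps t *: pmeval E (mu1 t)) 0 ->
  mcvg F (fun t => eps t *: pmeval E (mu2 t)) 0 ->
  (\forall t \near F, \det (pmeval P (mu1 t) + eps t *: pmeval E (mu1 t)) = 0) ->
  (\forall t \near F, \det (pmeval P (mu2 t) + eps t *: pmeval E (mu2 t)) = 0) ->
  \forall t \near F, mu1 t = mu2 t.
Proof.
move=> ceps r1 r2 c1 c2 d1 d2.
have [cmu1 cQ1 _] := perturbed_kernel c1 r1 d1.
have [cmu2 cQ2 [u cu Qu]] := perturbed_kernel c2 r2 d2.
have [|||||y cy Qy] := @ker_cvg R T F _ m (pmeval P z0)^T w^T v^T
  (fun t => (pmeval P (mu1 t) + eps t *: pmeval E (mu1 t))^T).
- exact: simple_ker_tr kerv w0 wP.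
- have [v0 _ _] := kerv.
  by rewrite -(inj_eq (@trmx_inj _ _ _)) trmxK trmx0.
- have [_ Pv _] := kerv; by rewrite -trmx_mul Pv trmx0.
- exact: mcvgT.
- by apply: filterS d1 => t; rewrite det_tr.
have cG : mcvg F (fun t => (y t)^T *m (mddiff P (mu2 t) (mu1 t) +
    eps t *: mddiff E (mu2 t) (mu1 t)) *m u t) (w *m mddiff P z0 z0 *m v).
  apply: mcvgM; last exact: cu.
  apply: mcvgM; first by rewrite -[w]trmxK; exact: mcvgT.
  rewrite -[X in mcvg _ _ X]addr0 -(scale0r (mddiff E z0 z0)).
  apply: mcvgD; first exact: mcvg_mddiff.
  by apply: mcvgZ; [exact: ceps|exact: mcvg_mddiff].
have nG := near_neq0 (cG 0 0) wPv.
near=> t.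
have Gt : ((y t)^T *m (mddiff P (mu2 t) (mu1 t) +
    eps t *: mddiff E (mu2 t) (mu1 t)) *m u t) 0 0 != 0 by near: t; exact: nG.
have Qut : (pmeval P (mu2 t) + eps t *: pmeval E (mu2 t)) *m u t = 0.
  by near: t; exact: Qu.
have Qyt : (y t)^T *m (pmeval P (mu1 t) + eps t *: pmeval E (mu1 t)) = 0.
  apply: trmx_inj; rewrite trmx_mul trmxK trmx0.
  by near: t; exact: Qy.
apply/eqP; rewrite eq_sym -subr_eq0.
have : (y t)^T *m ((pmeval P (mu2 t) + eps t *: pmeval E (mu2 t)) -
    (pmeval P (mu1 t) + eps t *: pmeval E (mu1 t))) *m u t = 0.
  by rewrite mulmxBr Qyt subr0 -mulmxA Qut mulmx0.
rewrite opprD addrACA -scalerBr !mddiffE scalerA mulrC -scalerA -scalerDr.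
rewrite -scalemxAr -scalemxAl => /matrixP/(_ 0 0)/eqP.
by rewrite mxE [X in _ == X]mxE mulf_eq0 (negPf Gt) orbF.
Unshelve. all: by end_near. Qed.

End AlongFilter.

(** The perturbation may raise the degree of the determinant, so a degree bound
    independent of the parameter is what [poly_root_in_disc] needs. *)
Lemma size_det_pencil (E : 'M[{poly C}]_m) :
  exists N : nat, forall c : C, (size (\det (P + c%:P *: E)) <= N.+1)%N.
Proof.
exists (\sum_i \sum_j (size (P i j) + size (E i j)))%N => c.
apply: leq_trans (size_sum _ _ _) _; apply/bigmax_leqP => s _.
rewrite size_Msign; apply: leq_trans (size_poly_prod_leq _ _) _.
apply: leq_trans (leq_subr _ _) _; rewrite ltnS.
apply: leq_sum => i _; rewrite (bigD1 (perm.fun_of_perm s i))//=; apply: leq_trans (leq_addr _ _).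
rewrite !mxE mul_polyC; apply: leq_trans (size_polyD _ _) _.
rewrite geq_max leq_addr /=; apply: leq_trans (size_scale_leq _ _) _.
exact: leq_addl.
Qed.

Lemma pmeval_perturbed (c : C) (E : 'M[{poly C}]_m) (mu : C) :
  pmeval (P + c%:P *: E) mu = pmeval P mu + c *: pmeval E mu.
Proof. by apply/matrixP => i j; rewrite !mxE hornerD hornerM hornerC. Qed.

(** [det P] vanishes at [z0] and not at [z0 + r]; by continuity in the parameter
    the determinant of the perturbed matrix is as small at [z0], compared with
    [z0 + r], as [poly_root_in_disc] requires. *)
Lemma perturbed_eigenvalue_exists (E : 'M[{poly C}]_m) :
  \forall e \near (0 : R)^'+, exists2 mu, cabs (mu - z0) <= r &
    \det (pmeval P mu + e%:C%C *: pmeval E mu) = 0.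
Proof.
have [r0 isor] := iso; have [N szN] := size_det_pencil E.
have detE (Q : 'M[{poly C}]_m) z : \det (pmeval Q z) = (\det Q).[z].
  by rewrite -horner_evalE -det_map_mx; congr (\det _).
have ce : e%:C%C @[e --> (0 : R)^'+] --> (0 : C).
  apply: cabs_cvg0; apply/cvgr0Pnorm_lt => d d0.
  near=> e; rewrite cabs_real normr_id gtr0_norm.
    by near: e; exact: nbhs_right_lt.
  by near: e; exact: nbhs_right_gt.
have cdet z : (\det (P + (e%:C%C)%:P *: E)).[z] @[e --> (0 : R)^'+] -->
    \det (pmeval P z).
  under eq_fun do rewrite -detE pmeval_perturbed.
  apply: cvg_det; rewrite -[X in mcvg _ _ X]addr0 -(scale0r (pmeval E z)).
  apply: mcvgD; first exact: mcvg_cst.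
  by apply: mcvgZ; [exact: ce|exact: mcvg_cst].
have d0 : \det (pmeval P z0) = 0.
  by have [v0 Pv _] := kerv; apply/det0_ker; exists v.
have dr : \det (pmeval P (z0 + r%:C%C)) != 0.
  apply/eqP => /det0_ker[u u0 Pu].
  have zr : z0 + r%:C%C - z0 = r%:C%C by rewrite addrC addKr.
  have /eqP : z0 + r%:C%C = z0.
    apply: isor; last by exists u.
    by rewrite zr cabs_real gtr0_norm.
  by rewrite -subr_eq0 zr -cabs_eq0 cabs_real normr_eq0 gt_eqF.
pose gap e := cabs (\det (P + (e%:C%C)%:P *: E)).[z0 + r%:C%C]
  - 2 ^+ N * cabs (\det (P + (e%:C%C)%:P *: E)).[z0].
have cgap : gap e @[e --> (0 : R)^'+] --> cabs (\det (pmeval P (z0 + r%:C%C))).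
  have c1 : cabs (\det (P + (e%:C%C)%:P *: E)).[z0 + r%:C%C]
      @[e --> (0 : R)^'+] --> cabs (\det (pmeval P (z0 + r%:C%C))).
    by apply: cvg_cabs; exact: cdet.
  have c2 : cabs (\det (P + (e%:C%C)%:P *: E)).[z0] @[e --> (0 : R)^'+] --> (0 : R).
    by rewrite -[X in _ --> X](Normc.normc0 R) -[X in cabs X]d0; apply: cvg_cabs; exact: cdet.
  have c3 : (fun=> 2 ^+ N : R) @ (0 : R)^'+ --> (2 ^+ N : R) by exact: cvg_cst.
  have := cvgB c1 (cvgM c3 c2).
  by rewrite mulr0 subr0 => h; exact: h.
have gap0 : \forall e \near (0 : R)^'+, 0 < gap e.
  by apply: (cvgr_gt _ cgap); rewrite cabs_gt0.
apply: filterS gap0 => e; rewrite subr_gt0 => gape.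
have [mu mur rt] := poly_root_in_disc r0 (szN e%:C%C) gape.
exists mu; first exact: mur.
by rewrite -pmeval_perturbed detE; apply/eqP.
Unshelve. all: by end_near. Qed.

End EigenvaluePerturbation.

(** * Structured perturbations and their weights *)

Section WeightedForms.
Variable R : realType.
Local Notation C := R[i].

Lemma pmeval_coefs k m n (M : 'I_k.+1 -> 'M[C]_(m, n)) (s : C) :
  pmeval (coefs_mx M) s = \sum_(i < k.+1) s ^+ i *: M i.
Proof.
apply/matrixP => i j; rewrite mxE /coefs_mx !summxE horner_sum.
by apply: eq_bigr => l _; rewrite !mxE hornerM hornerXn hornerC.
Qed.

Lemma coefs_form k m n (M : 'I_k.+1 -> 'M[C]_(m, n)) (s : C)
    (w : 'rV[C]_m) (u : 'cV[C]_n) :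
  (w *m pmeval (coefs_mx M) s *m u) 0 0 = \sum_(i < k.+1) s ^+ i * (w *m M i *m u) 0 0.
Proof.
rewrite pmeval_coefs mulmx_sumr mulmx_suml summxE; apply: eq_bigr => i _.
by rewrite -scalemxAr -scalemxAl mxE.
Qed.

Lemma wsum_ge0 k (a : 'I_k.+1 -> R) (s : C) : (forall i, 0 <= a i) -> 0 <= wsum a s.
Proof. by move=> a0; apply: sumr_ge0 => i _; rewrite mulr_ge0// exprn_ge0 ?cabs_ge0. Qed.

Lemma coefs_form_le k m n (M : 'I_k.+1 -> 'M[C]_(m, n)) (a : 'I_k.+1 -> R) (s : C)
    (w : 'rV[C]_m) (u : 'cV[C]_n) : (forall i, mnorm2 (M i) <= a i) ->
  cabs ((w *m pmeval (coefs_mx M) s *m u) 0 0) <= wsum a s * (vnorm2 w^T * vnorm2 u).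
Proof.
move=> Ma; rewrite coefs_form; apply: le_trans (cabs_sum _ _ _) _.
rewrite /wsum mulr_suml; apply: ler_sum => i _.
rewrite Normc.normcM cabsX mulrC mulrAC ler_wpM2r ?exprn_ge0 ?cabs_ge0//.
apply: le_trans (cabs_bilinear_le _ _ _) _.
by rewrite ler_wpM2r ?mulr_ge0 ?vnorm2_ge0.
Qed.

(** The phases of all the coefficients are aligned at the point [s], so that the
    triangle inequality of [coefs_form_le] becomes an equality.  The unimodular
    [sg] is the sign with which a block enters the system matrix. *)
Lemma coefs_form_extremal k m n (a : 'I_k.+1 -> R) (s sg : C)
    (w : 'rV[C]_m) (u : 'cV[C]_n) : (forall i, 0 <= a i) -> cabs sg = 1 ->
  exists2 M : 'I_k.+1 -> 'M[C]_(m, n), forall i, mnorm2 (M i) <= a i &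
    sg * (w *m pmeval (coefs_mx M) s *m u) 0 0 =
    (wsum a s * (vnorm2 w^T * vnorm2 u))%:C%C.
Proof.
move=> a0 sg1.
have /choice[M HM] : forall i : 'I_k.+1, exists M : 'M[C]_(m, n), mnorm2 M <= a i /\
    sg * s ^+ i * (w *m M *m u) 0 0 =
      (cabs (sg * s ^+ i) * (a i * (vnorm2 w^T * vnorm2 u)))%:C%C.
  by move=> i; have [M ? ?] := extremal_matrix w u (sg * s ^+ i) (a0 i); exists M.
exists M; first by move=> i; have [] := HM i.
rewrite coefs_form mulr_sumr /wsum mulr_suml rmorph_sum; apply: eq_bigr => i _.
have [_ H] := HM i; rewrite mulrA H; congr (_%:C%C).
by rewrite Normc.normcM sg1 mul1r cabsX mulrCA mulrA.
Qed.

Lemma cvg_wsum (T : Type) (F : set_system T) {FF : Filter F} k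
    (a : 'I_k.+1 -> R) (mu : T -> C) (z : C) :
  mu t @[t --> F] --> z -> wsum a (mu t) @[t --> F] --> wsum a z.
Proof.
move=> c; apply: cvg_big => [|i _]; first exact: add_continuous.
apply: cvgM; first exact: cvg_cst.
under eq_fun do rewrite -cabsX; rewrite -cabsX; apply: cvg_cabs.
have XE (y : C) : y ^+ i = ('X^i : {poly C}).[y] by rewrite hornerXn.
by rewrite XE; under eq_fun do rewrite XE; exact: cvg_horner.
Qed.

Lemma cvg_vnorm2 (T : Type) (F : set_system T) {FF : Filter F} n
    (u : T -> 'cV[C]_n) (v : 'cV[C]_n) :
  mcvg F u v -> vnorm2 (u t) @[t --> F] --> vnorm2 v.
Proof.
move=> c; apply: (@continuous_cvg _ _ _ _ _ _ (@Num.sqrt R)).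
  exact: sqrt_continuous.
apply: cvg_big => [|i _]; first exact: add_continuous.
have ci : cabs (u t i 0) @[t --> F] --> cabs (v i 0) by exact: cvg_cabs (c i 0).
by apply: (@cvgM R _ _ _ (fun t => cabs (u t i 0)) (fun t => cabs (u t i 0))).
Qed.

Section System.
Variables (n p kA kB kC kD : nat).
Variables (a : 'I_kA.+1 -> R) (b : 'I_kB.+1 -> R)
  (c : 'I_kC.+1 -> R) (d : 'I_kD.+1 -> R).
Hypotheses (ha : forall i, 0 <= a i) (hb : forall i, 0 <= b i)
  (hc : forall i, 0 <= c i) (hd : forall i, 0 <= d i).

Definition weight_form (al be ga de : R) (s : C) : R :=
  (row_mx al%:M be%:M *m weight_mx a b c d s *m col_mx ga%:M de%:M : 'M[R]_1) 0 0.

Lemma weight_formE al be ga de s : weight_form al be ga de s =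
  wsum a s * (al * ga) + wsum b s * (al * de) +
  (wsum c s * (be * ga) + wsum d s * (be * de)).
Proof.
rewrite /weight_form /weight_mx mul_row_block mul_row_col !mulmxDl -!scalar_mxM.
by rewrite !mxE !eqxx !mulr1n; ring.
Qed.

Lemma weight_form_ge0 al be ga de s : 0 <= al -> 0 <= be -> 0 <= ga -> 0 <= de ->
  0 <= weight_form al be ga de s.
Proof.
move=> *; rewrite weight_formE.
by rewrite !addr_ge0// mulr_ge0 ?wsum_ge0// mulr_ge0.
Qed.

Definition structured_pert (E : 'M[{poly C}]_(n + p)) : Prop :=
  exists (dA : 'I_kA.+1 -> 'M[C]_n) (dB : 'I_kB.+1 -> 'M[C]_(n, p))
         (dC : 'I_kC.+1 -> 'M[C]_(p, n)) (dD : 'I_kD.+1 -> 'M[C]_p),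
    [/\ forall i, mnorm2 (dA i) <= a i, forall i, mnorm2 (dB i) <= b i,
        forall i, mnorm2 (dC i) <= c i & forall i, mnorm2 (dD i) <= d i] /\
    E = system_mx (coefs_mx dA) (coefs_mx dB) (coefs_mx dC) (coefs_mx dD).

(** The largest modulus of the pairing of [w] and [u] with a structured
    perturbation evaluated at [s], by [structured_form_le] and
    [structured_form_extremal]. *)
Definition pert_weight (w : 'rV[C]_(n + p)) (u : 'cV[C]_(n + p)) (s : C) : R :=
  weight_form (vnorm2 (lsubmx w)^T) (vnorm2 (rsubmx w)^T)
              (vnorm2 (usubmx u)) (vnorm2 (dsubmx u)) s.

Lemma system_form (A : 'M[{poly C}]_n) (B : 'M[{poly C}]_(n, p))
    (Cm : 'M[{poly C}]_(p, n)) (D : 'M[{poly C}]_p)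
    (w : 'rV[C]_(n + p)) (u : 'cV[C]_(n + p)) (s : C) :
  (w *m pmeval (system_mx A B Cm D) s *m u) 0 0 =
  - (lsubmx w *m pmeval A s *m usubmx u) 0 0 + (lsubmx w *m pmeval B s *m dsubmx u) 0 0
  + ((rsubmx w *m pmeval Cm s *m usubmx u) 0 0 +
     (rsubmx w *m pmeval D s *m dsubmx u) 0 0).
Proof.
rewrite -[w in LHS]hsubmxK -[u in LHS]vsubmxK pmeval_system mul_row_block mul_row_col.
rewrite !mulmxDl mulmxN mulNmx; move: (lsubmx w *m _ *m _) => X1.
move: (lsubmx w *m _ *m _) => X2; move: (rsubmx w *m _ *m _) => X3.
move: (rsubmx w *m _ *m _) => X4; rewrite !mxE; ring.
Qed.

Lemma structured_form_le E w u s : structured_pert E ->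
  cabs ((w *m pmeval E s *m u) 0 0) <= pert_weight w u s.
Proof.
move=> [dA [dB [dC [dD [[bA bB bC bD] ->]]]]].
rewrite system_form /pert_weight weight_formE.
apply: le_trans (cabsD _ _) _; apply: lerD; apply: le_trans (cabsD _ _) _.
  by rewrite cabsN lerD// coefs_form_le.
by rewrite lerD// coefs_form_le.
Qed.

Lemma structured_form_extremal w u s : exists2 E, structured_pert E &
  (w *m pmeval E s *m u) 0 0 = (pert_weight w u s)%:C%C.
Proof.
have n1 : cabs (-1 : C) = 1 by rewrite cabsN Normc.normc1.
have [dA bA EA] := coefs_form_extremal s (lsubmx w) (usubmx u) ha n1.
have [dB bB EB] := coefs_form_extremal s (lsubmx w) (dsubmx u) hb (Normc.normc1 R).
have [dC bC EC] := coefs_form_extremal s (rsubmx w) (usubmx u) hc (Normc.normc1 R).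
have [dD bD ED] := coefs_form_extremal s (rsubmx w) (dsubmx u) hd (Normc.normc1 R).
exists (system_mx (coefs_mx dA) (coefs_mx dB) (coefs_mx dC) (coefs_mx dD)).
  by exists dA, dB, dC, dD.
rewrite system_form /pert_weight weight_formE !rmorphD /= -EA -EB -EC -ED.
by rewrite mulN1r !mul1r.
Qed.

Lemma pert_weight_cvg (T : Type) (F : set_system T) {FF : Filter F} w
    (u : T -> 'cV[C]_(n + p)) v (mu : T -> C) (z : C) :
  mcvg F u v -> mu t @[t --> F] --> z ->
  pert_weight w (u t) (mu t) @[t --> F] --> pert_weight w v z.
Proof.
move=> cu cmu.
have cus : vnorm2 (usubmx (u t)) @[t --> F] --> vnorm2 (usubmx v).
  apply: cvg_vnorm2 => i j; rewrite mxE; under eq_fun do rewrite mxE; exact: cu.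
have cds : vnorm2 (dsubmx (u t)) @[t --> F] --> vnorm2 (dsubmx v).
  apply: cvg_vnorm2 => i j; rewrite mxE; under eq_fun do rewrite mxE; exact: cu.
rewrite /pert_weight weight_formE; under eq_fun do rewrite weight_formE.
have cst (x : R) : (fun=> x) @ F --> x by exact: cvg_cst.
apply: cvgD; apply: cvgD; (apply: cvgM; first exact: cvg_wsum).
- exact: cvgM (cst _) cus.
- exact: cvgM (cst _) cds.
- exact: cvgM (cst _) cus.
- exact: cvgM (cst _) cds.
Qed.

(** An entry is the pairing with two vectors of the canonical basis, and the
    weight sums increase with the modulus of the point. *)
Lemma structured_pert_bounded (z0 : C) (r : R) (i j : 'I_(n + p)) :
  exists c0 : R, forall E s, structured_pert E -> cabs (s - z0) <= r ->
    cabs (pmeval E s i j) <= c0.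
Proof.
pose w : 'rV[C]_(n + p) := delta_mx 0 i; pose u : 'cV[C]_(n + p) := delta_mx j 0.
pose rho : C := (cabs z0 + r)%:C%C.
exists (pert_weight w u rho) => E s sE sr.
have -> : pmeval E s i j = (w *m pmeval E s *m u) 0 0 by rewrite -rowE -colE !mxE.
apply: le_trans (structured_form_le _ _ _ sE) _.
have wle k (e : 'I_k.+1 -> R) : (forall i, 0 <= e i) -> wsum e s <= wsum e rho.
  move=> e0; apply: ler_sum => l _; rewrite ler_wpM2l//.
  rewrite lerXn2r ?nnegrE ?cabs_ge0// cabs_real.
  apply: le_trans (ler_norm _); rewrite -{1}(subrK z0 s) addrC.
  by rewrite (le_trans (cabsD _ _))// lerD2l.
rewrite /pert_weight !weight_formE.
by rewrite !lerD// ler_wpM2r ?wle// mulr_ge0 ?vnorm2_ge0.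
Qed.

End System.
End WeightedForms.

(** * The structured condition number *)

Section StructuredCondition.
Variables (R : realType) (n p kA kB kC kD : nat).
Local Notation C := R[i].
Variables (a : 'I_kA.+1 -> R) (b : 'I_kB.+1 -> R)
  (c : 'I_kC.+1 -> R) (d : 'I_kD.+1 -> R).
Hypotheses (ha : forall i, 0 <= a i) (hb : forall i, 0 <= b i)
  (hc : forall i, 0 <= c i) (hd : forall i, 0 <= d i).
Variables (P : 'M[{poly C}]_(n + p)) (z0 : C) (r : R).
Variables (v : 'cV[C]_(n + p)) (w : 'rV[C]_(n + p)).
Hypotheses (regP : \det P != 0) (iso : isolating_radius P z0 r).
Hypotheses (kerv : simple_ker (pmeval P z0) v) (w0 : w != 0).
Hypothesis wP : w *m pmeval P z0 = 0.
Hypothesis wPv : (w *m mddiff P z0 z0 *m v) 0 0 != 0.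

Local Notation spert := (structured_pert a b c d).
Local Notation pw := (pert_weight a b c d).
Let K := cabs ((w *m mddiff P z0 z0 *m v) 0 0).
Let kappa := K^-1 * pw w v z0.

Lemma eigenvalue_det (Q : 'M[{poly C}]_(n + p)) mu :
  eigenvalue_at Q mu <-> \det (pmeval Q mu) = 0.
Proof.
split=> [[u [u0 Qu]]|/det0_ker[u u0 Qu]]; first by apply/det0_ker; exists u.
by exists u.
Qed.

Section Quotient.
Variables (T : Type) (F : set_system T).
Context {FF : Filter F}.
Variables (eps : T -> R) (E : T -> 'M[{poly C}]_(n + p)) (mu : T -> C).
Hypothesis eps0 : \forall t \near F, 0 < eps t.
Hypothesis ceps : (eps t)%:C%C @[t --> F] --> (0 : C).
Hypothesis sE : \forall t \near F, spert (E t).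
Hypothesis mur : \forall t \near F, cabs (mu t - z0) <= r.

Lemma structured_pert_cvg0 : mcvg F (fun t => (eps t)%:C%C *: pmeval (E t) (mu t)) 0.
Proof.
move=> i j; rewrite mxE.
have [c0 Hc0] := structured_pert_bounded ha hb hc hd z0 r i j.
have bd : exists M : R, \forall t \near F, cabs (pmeval (E t) (mu t) i j) <= M.
  exists c0; near=> t; apply: Hc0; first by near: t; exact: sE.
  by near: t; exact: mur.
apply: cvg_trans (bounded_cvg0 bd ceps); apply: near_eq_cvg.
have XE t : pmeval (E t) (mu t) i j * (eps t)%:C%C =
    ((eps t)%:C%C *: pmeval (E t) (mu t)) i j by rewrite [in RHS]mxE mulrC.
by near=> t; rewrite XE.
Unshelve. all: by end_near. Qed.

Hypothesis dQ : \forall t \near F,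
  \det (pmeval P (mu t) + (eps t)%:C%C *: pmeval (E t) (mu t)) = 0.

(** [perturbation_identity] divided by [eps]: everything on the right converges,
    except for the direction [E] of the perturbation. *)
Lemma eigenvalue_quotient : exists2 u : T -> 'cV[C]_(n + p),
  mcvg F u v /\ mu t @[t --> F] --> z0 &
  \forall t \near F, cabs (mu t - z0) / eps t =
    (cabs ((w *m mddiff P (mu t) z0 *m u t) 0 0))^-1 *
    cabs ((w *m pmeval (E t) (mu t) *m u t) 0 0).
Proof.
have [cmu _ [u cu Qu]] :=
  perturbed_kernel regP iso kerv w0 wP structured_pert_cvg0 mur dQ.
exists u; first by split; [exact: cu|exact: cmu].
have cG : mcvg F (fun t => w *m mddiff P (mu t) z0 *m u t) (w *m mddiff P z0 z0 *m v).
  apply: mcvgM; last exact: cu.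
  apply: mcvgM; first exact: mcvg_cst.
  by apply: mcvg_mddiff; [exact: cmu|exact: cvg_cst].
have nG := near_neq0 (cG 0 0) wPv.
near=> t.
have e0 : 0 < eps t by near: t; exact: eps0.
have Gt : (w *m mddiff P (mu t) z0 *m u t) 0 0 != 0 by near: t; exact: nG.
have := @perturbation_identity R _ P z0 w wP (mu t) _ (u t).
move=> /(_ ((eps t)%:C%C *: pmeval (E t) (mu t))) H.
have {}H : (mu t - z0) * (w *m mddiff P (mu t) z0 *m u t) 0 0 =
    - (w *m ((eps t)%:C%C *: pmeval (E t) (mu t)) *m u t) 0 0.
  by apply: H; near: t; exact: Qu.
have ZE : (w *m ((eps t)%:C%C *: pmeval (E t) (mu t)) *m u t) 0 0 =
    (eps t)%:C%C * (w *m pmeval (E t) (mu t) *m u t) 0 0.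
  by rewrite -scalemxAr -scalemxAl mxE.
move: H; rewrite ZE => /(congr1 (@Normc.normc R)).
rewrite cabsN !Normc.normcM cabs_real gtr0_norm// => H.
have G0 : cabs ((w *m mddiff P (mu t) z0 *m u t) 0 0) != 0 by rewrite cabs_eq0.
apply: (mulIf G0); rewrite mulrAC H [RHS]mulrAC mulVf// mul1r.
by rewrite mulrAC mulfV ?mul1r// gt_eqF.
Unshelve. all: by end_near. Qed.

Lemma mddiff_form_cvg (u : T -> 'cV[C]_(n + p)) : mcvg F u v ->
  mu t @[t --> F] --> z0 ->
  (cabs ((w *m mddiff P (mu t) z0 *m u t) 0 0))^-1 @[t --> F] --> K^-1.
Proof.
move=> cu cmu; apply: cvgV; first by rewrite cabs_eq0.
have cG : mcvg F (fun t => w *m mddiff P (mu t) z0 *m u t) (w *m mddiff P z0 z0 *m v).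
  apply: mcvgM; last exact: cu.
  apply: mcvgM; first exact: mcvg_cst.
  by apply: mcvg_mddiff; [exact: cmu|exact: cvg_cst].
exact: cvg_cabs (cG 0 0).
Qed.

End Quotient.

(** Bound the pairing with [E] in [eigenvalue_quotient] by its weight and pass
    to the limit along the filter of all admissible perturbations, which makes
    the bound uniform in the direction [E]. *)
Lemma quotient_upper (del : R) : 0 < del -> exists2 e0 : R, 0 < e0 &
  forall e E mu, 0 < e -> e < e0 -> spert E -> cabs (mu - z0) <= r ->
    \det (pmeval P mu + e%:C%C *: pmeval E mu) = 0 ->
    cabs (mu - z0) / e <= kappa + del.
Proof.
move=> del0.
(* A point consists of the parameter, an eigenvalue and a direction. *)
pose T := (R * (C * 'M[{poly C}]_(n + p)))%type.
pose adm : set T := [set t | [/\ 0 < t.1, spert t.2.2, cabs (t.2.1 - z0) <= r &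
  \det (pmeval P t.2.1 + t.1%:C%C *: pmeval t.2.2 t.2.1) = 0]].
pose F := small_filter adm fst.
have FF : Filter F by exact: small_filter_filter.
have nadm : \forall t \near F, adm t by exact: small_filter_adm.
have ceps : (t.1)%:C%C @[t --> F] --> (0 : C) by apply: small_filter_cvg0 => t [].
have [||||u [cu cmu] qE] :=
  @eigenvalue_quotient T F FF fst (fun t => t.2.2) (fun t => t.2.1) _ ceps.
- by apply: filterS nadm => t [].
- by apply: filterS nadm => t [].
- by apply: filterS nadm => t [].
- by apply: filterS nadm => t [].
have cV := @mddiff_form_cvg T F FF _ u cu cmu.
have cW := @pert_weight_cvg R n p _ _ _ _ a b c d T F FF w u v (fun t => t.2.1) z0 cu cmu.
have cB := @cvgM _ T F FF _ _ _ _ cV cW.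
have lt : K^-1 * pw w v z0 < kappa + del by rewrite ltrDl.
have nB := cvgr_lt _ cB _ lt.
have [e0 e00 He0] : \forall t \near F, cabs (t.2.1 - z0) / t.1 <= kappa + del.
  near=> t.
  have -> : cabs (t.2.1 - z0) / t.1 =
    (cabs ((w *m mddiff P t.2.1 z0 *m u t) 0 0))^-1 *
    cabs ((w *m pmeval t.2.2 t.2.1 *m u t) 0 0) by near: t; exact: qE.
  apply: le_trans (_ : (cabs ((w *m mddiff P t.2.1 z0 *m u t) 0 0))^-1 *
    pw w (u t) t.2.1 <= _).
    apply: ler_wpM2l; first by rewrite invr_ge0 cabs_ge0.
    apply: structured_form_le.
    suff [] : adm t by [].
    by near: t; exact: nadm.
  by apply: ltW; near: t; exact: nB.
exists e0; first exact: e00.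
move=> e E mu he ee sE mur dQ.
by apply: (He0 (e, (mu, E))); split.
Unshelve. all: by end_near. Qed.

(** The direction [E] that is extremal at [z0] realizes the bound in the limit;
    it has a perturbed eigenvalue, which is unique in the disc. *)
Lemma quotient_lower (del : R) : 0 < del -> exists2 E, spert E &
  \forall e \near (0 : R)^'+, exists2 mu,
    perturbed_eigenvalue (P + (e%:C%C)%:P *: E) z0 r mu &
    kappa - del <= cabs (mu - z0) / e.
Proof.
move=> del0; have [E sE EE] := structured_form_extremal ha hb hc hd w v z0.
exists E; first exact: sE.
(* Two eigenvalues for the same parameter, so that uniqueness is a statement
   about a single filter. *)
pose T := (R * (C * C))%type.
pose adm : set T := [set t | [/\ 0 < t.1, cabs (t.2.1 - z0) <= r,
  cabs (t.2.2 - z0) <= r,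
  \det (pmeval P t.2.1 + t.1%:C%C *: pmeval E t.2.1) = 0 &
  \det (pmeval P t.2.2 + t.1%:C%C *: pmeval E t.2.2) = 0]].
pose F := small_filter adm fst.
have FF : Filter F by exact: small_filter_filter.
have nadm : \forall t \near F, adm t by exact: small_filter_adm.
have ceps : (t.1)%:C%C @[t --> F] --> (0 : C) by apply: small_filter_cvg0 => t [].
have mu1r : \forall t \near F, cabs (t.2.1 - z0) <= r by apply: filterS nadm => t [].
have mu2r : \forall t \near F, cabs (t.2.2 - z0) <= r by apply: filterS nadm => t [].
have sE' : \forall t \near F, spert E by apply: filterS nadm => t _.
have pos : \forall t \near F, 0 < t.1 by apply: filterS nadm => t [].
have d1 : \forall t \near F, \det (pmeval P t.2.1 + t.1%:C%C *: pmeval E t.2.1) = 0.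
  by apply: filterS nadm => t [_ _ _ dt _]; exact: dt.
have d2 : \forall t \near F, \det (pmeval P t.2.2 + t.1%:C%C *: pmeval E t.2.2) = 0.
  by apply: filterS nadm => t [_ _ _ _ dt]; exact: dt.
have c1 := @structured_pert_cvg0 T F FF fst (fun=> E) (fun t => t.2.1) ceps sE' mu1r.
have c2 := @structured_pert_cvg0 T F FF fst (fun=> E) (fun t => t.2.2) ceps sE' mu2r.
have un := @perturbed_eigenvalue_uniq _ _ _ _ _ _ _ regP iso kerv w0 wP T F FF wPv
  _ _ _ _ ceps mu1r mu2r c1 c2 d1 d2.
have [u [cu cmu] qE] :=
  @eigenvalue_quotient T F FF fst (fun=> E) (fun t => t.2.1) pos ceps sE' mu1r d1.
have cV := @mddiff_form_cvg T F FF _ u cu cmu.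
have cW : cabs ((w *m pmeval E t.2.1 *m u t) 0 0) @[t --> F] --> pw w v z0.
  have -> : pw w v z0 = cabs ((w *m pmeval E z0 *m v) 0 0).
    rewrite EE cabs_real ger0_norm// /pert_weight.
    by apply: weight_form_ge0 => //; exact: vnorm2_ge0.
  have cG : mcvg F (fun t : T => w *m pmeval E t.2.1 *m u t) (w *m pmeval E z0 *m v).
    apply: mcvgM; last exact: cu.
    by apply: mcvgM; [exact: mcvg_cst|exact: mcvg_pmeval].
  exact: cvg_cabs (cG 0 0).
have cB := @cvgM _ T F FF _ _ _ _ cV cW.
have lt : kappa - del < K^-1 * pw w v z0 by rewrite ltrBlDr ltrDl.
have nB := cvgr_gt _ cB _ lt.
have [e1 e10 He1] : \forall t \near F, t.2.1 = t.2.2 /\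
    kappa - del <= cabs (t.2.1 - z0) / t.1.
  near=> t; split; first by near: t; exact: un.
  have -> : cabs (t.2.1 - z0) / t.1 =
    (cabs ((w *m mddiff P t.2.1 z0 *m u t) 0 0))^-1 *
    cabs ((w *m pmeval E t.2.1 *m u t) 0 0) by near: t; exact: qE.
  by apply: ltW; near: t; exact: nB.
have ex := perturbed_eigenvalue_exists iso kerv E.
near=> e.
have e0 : 0 < e by near: e; exact: nbhs_right_gt.
have ee1 : e < e1 by near: e; exact: nbhs_right_lt.
have [mu mur dmu] : exists2 mu, cabs (mu - z0) <= r &
    \det (pmeval P mu + e%:C%C *: pmeval E mu) = 0 by near: e; exact: ex.
exists mu; last first.
  by have [] := He1 (e, (mu, mu)) (conj (And5 e0 mur mur dmu dmu) ee1).
split; [exact: mur|by apply/eigenvalue_det; rewrite pmeval_perturbed|].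
move=> mu' mu'r /eigenvalue_det; rewrite pmeval_perturbed => dmu'.
by have [] := He1 (e, (mu', mu)) (conj (And5 e0 mu'r mur dmu' dmu) ee1).
Unshelve. all: by end_near. Qed.

(** For a positive [e] every eigenvector of the perturbed matrix is of the form
    [vv + e dv], so the quotients are those of all the perturbed eigenvalues;
    the two bounds above then enclose their supremum. *)
Lemma structured_condE (vv : 'cV[C]_(n + p)) :
  structured_cond P a b c d z0 vv r kappa%:E.
Proof.
have bounds (del : R) : 0 < del -> \forall e \near (0 : R)^'+,
    ((kappa - del)%:E <= ereal_sup (structured_quotients P a b c d z0 vv r e) <=
     (kappa + del)%:E)%E.
  move=> del0; have [e1 e10 up] := quotient_upper del0.
  have [E [dA [dB [dC [dD [bnd EE]]]]] lo] := quotient_lower del0.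
  near=> e.
  have e0 : 0 < e by near: e; exact: nbhs_right_gt.
  have ee1 : e < e1 by near: e; exact: nbhs_right_lt.
  apply/andP; split; last first.
    apply: ge_ereal_sup => _ [dz [dA' [dB' [dC' [dD' [dv [bnd' [[zr ev _] _]]]]]]] <-].
    rewrite lee_fin.
    have zE : z0 + dz - z0 = dz by rewrite addrC addKr.
    rewrite -{1}zE; apply: (up _ _ _ e0 ee1 _ zr).
      by exists dA', dB', dC', dD'; split; [exact: bnd'|].
    by rewrite -pmeval_perturbed; apply/eigenvalue_det.
  have [mu pe le] : exists2 mu, perturbed_eigenvalue (P + (e%:C%C)%:P *: E) z0 r mu &
    kappa - del <= cabs (mu - z0) / e by near: e; exact: lo.
  apply: le_trans (_ : (cabs (mu - z0) / e)%:E <= _)%E; first by rewrite lee_fin.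
  apply: ereal_sup_ubound; exists (mu - z0) => //.
  have [_ [u [u0 Qu]] _] := pe.
  have ec0 : e%:C%C != 0 :> C by rewrite -cabs_eq0 cabs_real normr_eq0 gt_eqF.
  exists dA, dB, dC, dD, ((e%:C%C)^-1 *: (u - vv)); rewrite -EE.
  have -> : z0 + (mu - z0) = mu by rewrite addrC subrK.
  split; first exact: bnd.
  split; first exact: pe.
  have -> : vv + e%:C%C *: ((e%:C%C)^-1 *: (u - vv)) = u.
    by rewrite scalerA mulfV// scale1r addrC subrK.
  by split; [exact: u0|exact: Qu].
apply/fine_cvgP; split.
  have := bounds 1 ltr01; apply: filterS => e /andP[lo up].
  by rewrite fin_numElt (lt_le_trans _ lo) ?ltNyr// (le_lt_trans up) ?ltry.
apply/cvgrPdist_le => del del0; have := bounds del del0; apply: filterS => e /=.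
case: (ereal_sup _) => [s| |] /andP[] //; rewrite !lee_fin => lo up.
by rewrite ler_distlC; apply/andP; split.
Unshelve. all: by end_near. Qed.

End StructuredCondition.

Theorem theorem4p4 (R : realType) (n p kA kB kC kD : nat)
  (A : 'M[{poly R[i]}]_n) (B : 'M[{poly R[i]}]_(n, p))
  (C : 'M[{poly R[i]}]_(p, n)) (D : 'M[{poly R[i]}]_p)
  (hA : size_bound kA A) (hB : size_bound kB B)
  (hC : size_bound kC C) (hD : size_bound kD D)
  (regA : \det A != 0) (regP : \det (system_mx A B C D) != 0)
  (z0 : R[i])
  (hz0 : simple_zero (transfer_fun A B C D) z0)
  (hmin : minimal_at A B C z0)
  (x y : 'cV[{fraction {poly R[i]}}]_p)
  (hx : right_root_vector (transfer_fun A B C D) z0 x)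
  (hy : left_root_vector (transfer_fun A B C D) z0 y)
  (a : 'I_kA.+1 -> R) (b : 'I_kB.+1 -> R)
  (c : 'I_kC.+1 -> R) (d : 'I_kD.+1 -> R)
  (ha : forall i, 0 <= a i) (hb : forall i, 0 <= b i)
  (hc : forall i, 0 <= c i) (hd : forall i, 0 <= d i)
  (v : 'cV[R[i]]_(n + p)) (hv : eigenvector_at (system_mx A B C D) z0 v)
  (r : R) (hr : isolating_radius (system_mx A B C D) z0 r) :
  exists (K : R) (AinvBx : 'cV[R[i]]_n) (yCAinv : 'rV[R[i]]_n),
    [/\ rmeval (invmx (ratmx A) *m ratmx B *m x) t @[t --> z0^'] --> AinvBx,
        rmeval (y^T *m ratmx C *m invmx (ratmx A)) t @[t --> z0^'] --> yCAinv,
        0 < K,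
        cabs (((rmeval y t)^T *m rmderiv (transfer_fun A B C D) t
                 *m rmeval x t) 0 0) @[t --> z0^'] --> K &
        structured_cond (system_mx A B C D) a b c d z0 v r
          (K^-1 *
            (row_mx (vnorm2 yCAinv^T)%:M (vnorm2 (rmeval y z0))%:M
              *m weight_mx a b c d z0
              *m col_mx (vnorm2 AinvBx)%:M (vnorm2 (rmeval x z0))%:M
              : 'M[R]_1) 0 0)%:E].
Proof.
have [npx x0 Tx0] := hx; have [npy y0 yT0] := hy.
have xv : mval_at z0 x (rmeval x z0) by apply/mval_atP; split.
have yv : mval_at z0 y (rmeval y z0) by apply/mval_atP; split.
have Tx := mreval_cvg Tx0; have yT := mreval_cvg yT0.
have [u0 [w0 [uv wv kerv wP wPv]]] :=
  system_kernels regA hmin hz0 xv yv x0 y0 Tx yT.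
exists (cabs ((row_mx w0 (rmeval y z0)^T *m mddiff (system_mx A B C D) z0 z0
  *m col_mx u0 (rmeval x z0)) 0 0)), u0, w0; split.
- by apply/mcvgP; exact: mval_at_cvg.
- by apply/mcvgP; exact: mval_at_cvg.
- by rewrite cabs_gt0.
- exact: transfer_derivative_limit.
have w1 : row_mx w0 (rmeval y z0)^T != 0.
  by apply: contra_neq wPv => ->; rewrite !mul0mx mxE.
have := structured_condE ha hb hc hd regP hr kerv w1 wP wPv v.
by rewrite /pert_weight row_mxKl row_mxKr col_mxKu col_mxKd trmxK.
Qed.
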